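(* Let $H$ be a Hopf algebra and $B$ a left $H$-module algebra with action $\triangleright$, and consider the Hopf algebroid $B^e\#H$ over $B$. Then $Z^1(B^e\#H,B)\simeq Z^1_{\triangleright,as}(H,B)$ and $C^1(B^e\#H,B)\simeq C^1_{\triangleright,as}(H,B)$ as groups. Moreover, there are bijections $Z^2(B^e\#H,B)\simeq Z^2_{\triangleright,as}(H,B)$ and $\mathcal H^2(B^e\#H,B)\simeq\mathcal H^2_{\triangleright,as}(H,B)$.
   Context: All algebras are unital associative over a field $k$. $B^e=B\otimes B^{op}$. The Hopf algebroid $\mathcal L=B^e\#H$ is the vector space $B\otimes B\otimes H$ with product $(b\otimes b'\#h)(c\otimes c'\#g)=b(h_{(1)}\triangleright c)\otimes c'(S(g_{(2)})\triangleright b')\#h_{(2)}g_{(1)}$ (products in $B$), source $s(b)=b\otimes1\#1$, target $t(b)=1\otimes b\#1$, $B$-bimodule structure $c.(b\otimes b'\#h).c'=s(c)t(c')(b\otimes b'\#h)=cb\otimes b'(S(h_{(2)})\triangleright c')\#h_{(1)}$, coproduct $\Delta(b\otimes b'\#h)=(b\otimes1\#h_{(1)})\otimes_B(1\otimes b'\#h_{(2)})$ and counit $\varepsilon(b\otimes b'\#h)=b(h\triangleright b')$. It is a left bialgebroid over $B$. For $\mathcal L$ a left bialgebroid over $B$ (with $\Delta X=X_{(1)}\otimes_BX_{(2)}$, where $\mathcal L\otimes_B\mathcal L$ is the quotient by $t(b)X\otimes Y=X\otimes s(b)Y$): $C^1(\mathcal L,B)$ is the group, under convolution $(f\star g)(X)=f(X_{(1)})g(X_{(2)})$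 with unit $\varepsilon$, of convolution-invertible $B$-bimodule maps $U:\mathcal L\to B$ with $U(1)=1$ and $U(Xs(b))=U(Xt(b))$. $Z^1(\mathcal L,B)$ is the set of $U\in C^1(\mathcal L,B)$ with $U^{-1}(X_{(1)}t(U^{-1}(Y_{(1)})))U(X_{(2)}Y_{(2)})=\varepsilon(XY)$ for all $X,Y$, under convolution. Let $\mathcal L\otimes_{B^e}\mathcal L$ be the quotient by $Xs(a)t(b)\otimes Y=X\otimes s(a)t(b)Y$ with $b.(X,Y).c=(s(b)t(c)X,Y)$. $Z^2(\mathcal L,B)$ is the set of $\Gamma\in{}_B\mathrm{Hom}_B(\mathcal L\otimes_{B^e}\mathcal L,B)$ invertible for $(f\star g)(X,Y)=f(X_{(1)},Y_{(1)})g(X_{(2)},Y_{(2)})$ (unit $\varepsilon(XY)$) with $\Gamma(X,s(\Gamma(Y_{(1)},Z_{(1)}))Y_{(2)}Z_{(2)})=\Gamma(s(\Gamma(X_{(1)},Y_{(1)}))X_{(2)}Y_{(2)},Z)$, $\Gamma(1,X)=\varepsilon(X)=\Gamma(X,1)$, $\Gamma(X,Ys(b))=\Gamma(X,Yt(b))$. $C^1(\mathcal L,B)$ acts on $Z^2(\mathcal L,B)$ by $\Gamma^U(X,Y)=U^{-1}(X_{(1)}t(U^{-1}(Y_{(1)})))\Gamma(X_{(2)},Y_{(2)})U(X_{(3)}Y_{(3)})$, and $\mathcal H^2(\mathcal L,B)$ is the set of orbits. On the Hopf algebra side: $Z^1_{\triangleright,as}(H,B)$ is the set of unital linear $u:H\to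 B$ with $u(hg)=(h_{(1)}\triangleright u(g))u(h_{(2)})$ and $(h_{(1)}\triangleright b)u(h_{(2)})=u(h_{(1)})(h_{(2)}\triangleright b)$ for all $h,g\in H$, $b\in B$; $C^1_{\triangleright,as}(H,B)$ is the set of unital convolution-invertible linear $u:H\to B$ with $(h_{(1)}\triangleright b)u(h_{(2)})=u(h_{(1)})(h_{(2)}\triangleright b)$; both are groups under convolution. $Z^2_{\triangleright,as}(H,B)$ is the set of convolution-invertible linear $\gamma:H\otimes H\to B$ with $\gamma(h,1)=\gamma(1,h)=\varepsilon(h)1$, $(h_{(1)}\triangleright\gamma(g_{(1)},f_{(1)}))\gamma(h_{(2)},g_{(2)}f_{(2)})=\gamma(h_{(1)},g_{(1)})\gamma(h_{(2)}g_{(2)},f)$ and $\gamma(h_{(1)},g_{(1)})((h_{(2)}g_{(2)})\triangleright b)=((h_{(1)}g_{(1)})\triangleright b)\gamma(h_{(2)},g_{(2)})$. $C^1_{\triangleright,as}(H,B)$ acts on $Z^2_{\triangleright,as}(H,B)$ by $\gamma^u(h,g)=u^{-1}(h_{(1)})(h_{(2)}\triangleright u^{-1}(g_{(1)}))\gamma(h_{(3)},g_{(2)})u(h_{(4)}g_{(3)})$ and $\mathcal H^2_{\triangleright,as}(H,B)$ is the set of orbits. *)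

(* Defs.v *)
From HB Require Import structures.
From mathcomp Require Import all_boot all_order all_algebra.
From mathcomp Require Import boolp classical_sets functions.

Set Implicit Arguments.
Unset Strict Implicit.
Unset Printing Implicit Defensive.

Import GRing.Theory.
Local Open Scope quotient_scope.
Local Open Scope classical_set_scope.
Local Open Scope ring_scope.

Declare Scope sweedler_scope.
Delimit Scope sweedler_scope with SW.
Local Open Scope sweedler_scope.

(** Given families [ra a : U -> U] and [la a : V -> V], the type [btens ra la]
    is the quotient of the tensor product of [U] and [V] over [k] by the
    relations [ra a u ⊗ v = u ⊗ la a v]. A finite sequence of pairs stands for
    the formal sum of its members. *)

Section BalancedTensor.
Variables (k : fieldType) (U V : lmodType k) (A : Type).
Variables (ra : A -> U -> U) (la : A -> V -> V).

Definition fsum_scale (c : k) (s : seq (U * V)) : seq (U * V) :=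
  [seq (c *: p.1, p.2) | p <- s].

Inductive tens_rel : seq (U * V) -> seq (U * V) -> Prop :=
| TR_refl s : tens_rel s s
| TR_sym s t : tens_rel s t -> tens_rel t s
| TR_trans s t r : tens_rel s t -> tens_rel t r -> tens_rel s r
| TR_cat s s' t t' :
    tens_rel s s' -> tens_rel t t' -> tens_rel (s ++ t) (s' ++ t')
| TR_comm s t : tens_rel (s ++ t) (t ++ s)
| TR_scale c s t : tens_rel s t -> tens_rel (fsum_scale c s) (fsum_scale c t)
| TR_zero v : tens_rel [:: (0, v)] [::]
| TR_addl u u' v : tens_rel [:: (u + u', v)] [:: (u, v); (u', v)]
| TR_addr u v v' : tens_rel [:: (u, v + v')] [:: (u, v); (u, v')]
| TR_scal c u v : tens_rel [:: (c *: u, v)] [:: (u, c *: v)]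
| TR_bal a u v : tens_rel [:: (ra a u, v)] [:: (u, la a v)].

Definition tens_relb (s t : seq (U * V)) : bool := `[< tens_rel s t >].

Lemma tens_relb_refl : reflexive tens_relb.
Proof. by move=> s; apply/asboolP; apply: TR_refl. Qed.

Lemma tens_relb_sym : symmetric tens_relb.
Proof. by move=> s t; apply/asboolP/asboolP; apply: TR_sym. Qed.

Lemma tens_relb_trans : transitive tens_relb.
Proof.
by move=> t s r /asboolP st /asboolP tr; apply/asboolP; apply: TR_trans tr.
Qed.

Canonical tens_equiv :=
  EquivRel tens_relb tens_relb_refl tens_relb_sym tens_relb_trans.

Definition btens := {eq_quot tens_equiv}.
HB.instance Definition _ : EqQuotient _ tens_relb btens := EqQuotient.on btens.
HB.instance Definition _ := Choice.on btens.

Lemma btens_eqP (s t : seq (U * V)) : tens_rel s t <-> \pi_btens s = \pi_btens t.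
Proof.
by split=> [st|/eqmodP /asboolP//]; apply/eqmodP; apply/asboolP.
Qed.

Definition pure (u : U) (v : V) : btens := \pi_btens [:: (u, v)].

Definition btens_zero : btens := \pi_btens [::].
Definition btens_add (x y : btens) : btens := \pi_btens (repr x ++ repr y).
Definition btens_scale (c : k) (x : btens) : btens :=
  \pi_btens (fsum_scale c (repr x)).
Definition btens_opp (x : btens) : btens := btens_scale (-1) x.

Lemma btens_addE s t : btens_add (\pi s) (\pi t) = \pi_btens (s ++ t).
Proof. by apply/btens_eqP; apply: TR_cat; apply/btens_eqP; rewrite reprK. Qed.

Lemma btens_scaleE c s : btens_scale c (\pi s) = \pi_btens (fsum_scale c s).
Proof. by apply/btens_eqP; apply: TR_scale; apply/btens_eqP; rewrite reprK. Qed.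

Lemma btens_addA : associative btens_add.
Proof.
by elim/quotW=> x; elim/quotW=> y; elim/quotW=> z; rewrite !btens_addE catA.
Qed.

Lemma btens_addC : commutative btens_add.
Proof.
elim/quotW=> x; elim/quotW=> y; rewrite !btens_addE.
exact/btens_eqP/TR_comm.
Qed.

Lemma btens_add0 : left_id btens_zero btens_add.
Proof. by elim/quotW=> x; rewrite btens_addE. Qed.

Lemma btens_scaleDl x c d :
  btens_scale (c + d) x = btens_add (btens_scale c x) (btens_scale d x).
Proof.
have cons_add p r : \pi_btens (p :: r) = btens_add (\pi [:: p]) (\pi r).
  by rewrite btens_addE.
elim/quotW: x => s; rewrite !btens_scaleE.
elim: s => [|[u v] s IHs] /=; first by rewrite btens_addE.
rewrite (cons_add _ (fsum_scale (c + d) s)).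
rewrite (cons_add _ (fsum_scale c s)) (cons_add _ (fsum_scale d s)) IHs.
have -> : \pi_btens [:: ((c + d) *: u, v)] =
    btens_add (\pi [:: (c *: u, v)]) (\pi [:: (d *: u, v)]).
  by rewrite scalerDl btens_addE; apply/btens_eqP/TR_addl.
rewrite -!btens_addA; congr (btens_add _ _).
rewrite !btens_addA; congr (btens_add _ _).
exact: btens_addC.
Qed.

Lemma btens_scale0 x : btens_scale 0 x = btens_zero.
Proof.
elim/quotW: x => s; rewrite btens_scaleE; apply/btens_eqP.
elim: s => [|[u v] s IHs]; first exact: TR_refl.
by apply: (TR_cat (s := [:: _]) (s' := [::])) IHs; rewrite scale0r; apply: TR_zero.
Qed.

Lemma btens_scale1 : left_id 1 btens_scale.
Proof.
elim/quotW=> s; rewrite btens_scaleE /fsum_scale; congr (\pi _).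
by rewrite -[RHS]map_id; apply: eq_map => -[u v]; rewrite scale1r.
Qed.

Lemma btens_addN : left_inverse btens_zero btens_opp btens_add.
Proof.
move=> x; rewrite -{2}(btens_scale1 x) -btens_scaleDl addNr.
exact: btens_scale0.
Qed.

Lemma btens_scaleA c d x :
  btens_scale c (btens_scale d x) = btens_scale (c * d) x.
Proof.
elim/quotW: x => s; rewrite !btens_scaleE /fsum_scale -map_comp.
by congr (\pi _); apply: eq_map => -[u v] /=; rewrite scalerA.
Qed.

Lemma btens_scaleDr : right_distributive btens_scale btens_add.
Proof.
move=> c; elim/quotW=> s; elim/quotW=> t.
by rewrite btens_addE !btens_scaleE btens_addE /fsum_scale map_cat.
Qed.

HB.instance Definition _ :=
  GRing.isZmodule.Build btens btens_addA btens_addC btens_add0 btens_addN.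
HB.instance Definition _ :=
  GRing.Zmodule_isLmodule.Build k btens
    btens_scaleA btens_scale1 btens_scaleDr (fun x c d => btens_scaleDl x c d).

(** The sum of [F u v] over the terms [u ⊗ v] of a chosen representative of
    [x]; by [tsum_pi] it does not depend on the choice when [F] is bilinear and
    balanced, and is then the value at [x] of the map induced by [F]. *)
Definition tsum (W : nmodType) (x : btens) (F : U -> V -> W) : W :=
  \sum_(p <- repr x) F p.1 p.2.

Lemma tsum_pi (W : lmodType k) (F : U -> V -> W) (s : seq (U * V)) :
    (forall v, linear (F ^~ v)) -> (forall u, linear (F u)) ->
    (forall a u v, F (ra a u) v = F u (la a v)) ->
  tsum (\pi_btens s) F = \sum_(p <- s) F p.1 p.2.
Proof.
move=> Fl Fr Fbal.
have F0 v : F 0 v = 0 by have := Fl v (-1) 0 0; rewrite scaleN1r oppr0 addr0 scaleN1r addNr.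
have FDl u u' v : F (u + u') v = F u v + F u' v.
  by have := Fl v 1 u u'; rewrite !scale1r.
have FZl c u v : F (c *: u) v = c *: F u v.
  by have := Fl v c u 0; rewrite !addr0 F0 addr0.
have FDr u v v' : F u (v + v') = F u v + F u v'.
  by have := Fr u 1 v v'; rewrite !scale1r.
have Fr0 u : F u 0 = 0.
  by have := Fr u (-1) 0 0; rewrite scaleN1r oppr0 addr0 scaleN1r addNr.
have FZr c u v : F u (c *: v) = c *: F u v.
  by have := Fr u c v 0; rewrite !addr0 Fr0 addr0.
suff rel t r : tens_rel t r -> \sum_(p <- t) F p.1 p.2 = \sum_(p <- r) F p.1 p.2.
  by apply: rel; apply/btens_eqP; rewrite reprK.
elim=> {t r} //.
- by move=> t t' r _ -> _ ->.
- by move=> t t' r r' _ tt' _ rr'; rewrite !big_cat tt' rr'.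
- by move=> t r; rewrite !big_cat /= addrC.
- move=> c t r _ tr; rewrite !big_map /=.
  under eq_bigr => p _ do rewrite FZl.
  by under [RHS]eq_bigr => p _ do rewrite FZl; rewrite -!scaler_sumr tr.
- by move=> v; rewrite big_seq1 big_nil F0.
- by move=> u u' v; rewrite !big_cons !big_nil !addr0 FDl.
- by move=> u v v'; rewrite !big_cons !big_nil !addr0 FDr.
- by move=> c u v; rewrite !big_seq1 FZl FZr.
- by move=> a u v; rewrite !big_seq1 Fbal.
Qed.

Lemma tsum_pure (W : lmodType k) (F : U -> V -> W) (u : U) (v : V) :
    (forall v, linear (F ^~ v)) -> (forall u, linear (F u)) ->
    (forall a u v, F (ra a u) v = F u (la a v)) ->
  tsum (pure u v) F = F u v.
Proof. by move=> Fl Fr Fbal; rewrite tsum_pi // big_seq1. Qed.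

End BalancedTensor.

Arguments btens {k U V A} ra la.
Arguments pure {k U V A ra la} u v.

Notation "\ten_ ( x , y <- t ) E" := (tsum t (fun x y => E))
  (at level 41, x name, y name, E at level 41, right associativity,
   format "\ten_ ( x ,  y  <-  t )  E") : sweedler_scope.

Definition tens (k : fieldType) (U V : lmodType k) : Type :=
  btens (fun (c : k) (u : U) => c *: u) (fun (c : k) (v : V) => c *: v).

HB.instance Definition _ (k : fieldType) (U V : lmodType k) :=
  GRing.Lmodule.on (tens U V).

Definition tpure (k : fieldType) (U V : lmodType k) (u : U) (v : V) : tens U V :=
  pure u v.

Notation "u ⊗ v" := (tpure u v) (at level 39, left associativity) : sweedler_scope.

HB.mixin Record isHopfAlgebra (k : fieldType) H of GRing.Algebra k H := {
  comul : H -> tens H H;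
  counit : H -> k;
  antipode : H -> H;
  comul_linear : linear comul;
  counit_linear : scalar counit;
  antipode_linear : linear antipode;
  comulA : forall h : H,
    \ten_(h', h3 <- comul h) \ten_(h1, h2 <- comul h') h1 ⊗ (h2 ⊗ h3) =
    \ten_(h1, h' <- comul h) \ten_(h2, h3 <- comul h') h1 ⊗ (h2 ⊗ h3);
  counitl : forall h : H, \ten_(h1, h2 <- comul h) counit h1 *: h2 = h;
  counitr : forall h : H, \ten_(h1, h2 <- comul h) counit h2 *: h1 = h;
  comul1 : comul 1 = 1 ⊗ 1;
  comulM : forall h g : H, comul (h * g) =
    \ten_(h1, h2 <- comul h) \ten_(g1, g2 <- comul g) (h1 * g1) ⊗ (h2 * g2);
  counit1 : counit 1 = 1;
  counitM : forall h g : H, counit (h * g) = counit h * counit g;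
  antipodel : forall h : H,
    \ten_(h1, h2 <- comul h) antipode h1 * h2 = (counit h)%:A;
  antipoder : forall h : H,
    \ten_(h1, h2 <- comul h) h1 * antipode h2 = (counit h)%:A
}.

#[short(type="hopfAlgType")]
HB.structure Definition HopfAlgebra (k : fieldType) :=
  {H of GRing.Algebra k H & isHopfAlgebra k H}.

HB.mixin Record isModuleAlgebra (k : fieldType) (H : hopfAlgType k) B
    of GRing.Algebra k B := {
  hact : H -> B -> B;
  hact_linearl : forall b : B, linear (hact^~ b);
  hact_linearr : forall h : H, linear (hact h);
  hact1 : forall b : B, hact 1 b = b;
  hactA : forall (h g : H) (b : B), hact (h * g) b = hact h (hact g b);
  hact_one : forall h : H, hact h 1 = counit h *: 1;
  hactM : forall (h : H) (b c : B),
    hact h (b * c) = \ten_(h1, h2 <- comul h) hact h1 b * hact h2 c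
}.

#[short(type="modAlgType")]
HB.structure Definition ModuleAlgebra (k : fieldType) (H : hopfAlgType k) :=
  {B of GRing.Algebra k B & isModuleAlgebra k H B}.

Notation "h ▷ b" := (hact h b) (at level 38, right associativity) : sweedler_scope.

Definition inverse_in (T : Type) (A : set T) (op : T -> T -> T) (e u v : T) :=
  [/\ A v, op u v = e & op v u = e].

Definition invertible_in (T : Type) (A : set T) (op : T -> T -> T) (e u : T) :=
  exists v, inverse_in A op e u v.

(** The inverse of [u] if it has one, and [u] otherwise. *)
Definition inv_in (T : choiceType) (A : set T) (op : T -> T -> T) (e u : T) : T :=
  xget u [set v | inverse_in A op e u v].

Definition is_group (T : Type) (A : set T) (op : T -> T -> T) (e : T) :=
  [/\ A e,
      forall u v, A u -> A v -> A (op u v),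
      forall u v w, A u -> A v -> A w -> op u (op v w) = op (op u v) w,
      forall u, A u -> op e u = u /\ op u e = u
    & forall u, A u -> invertible_in A op e u].

Definition group_isomorphic (T T' : Type)
    (A : set T) (op : T -> T -> T) (e : T)
    (A' : set T') (op' : T' -> T' -> T') (e' : T') :=
  [/\ is_group A op e, is_group A' op' e'
    & exists phi : T -> T', set_bij A A' phi /\
        forall u v, A u -> A v -> phi (op u v) = op' (phi u) (phi v)].

Definition bijective_sets (T T' : Type) (A : set T) (A' : set T') :=
  exists phi : T -> T', set_bij A A' phi.

(** Only the operations of a left bialgebroid are recorded: its axioms are not
    used in the definitions below. *)
Record bialgebroid_ops (k : fieldType) (B : algType k) := BialgebroidOps {
  bgd_carrier :> lmodType k;
  bgd_mul : bgd_carrier -> bgd_carrier -> bgd_carrier;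
  bgd_one : bgd_carrier;
  bgd_src : B -> bgd_carrier;
  bgd_tgt : B -> bgd_carrier;
  bgd_comul : bgd_carrier ->
    btens (fun b X => bgd_mul (bgd_tgt b) X) (fun b Y => bgd_mul (bgd_src b) Y);
  bgd_counit : bgd_carrier -> B
}.

Section BialgebroidCohomology.
Variables (k : fieldType) (B : algType k) (L : bialgebroid_ops B).

Local Notation "X ∙ Y" := (bgd_mul X Y) (at level 40, left associativity).
Local Notation "1L" := (bgd_one L).
Local Notation s := (@bgd_src k B L).
Local Notation t := (@bgd_tgt k B L).
Local Notation Δ := (@bgd_comul k B L).
Local Notation ε := (@bgd_counit k B L).

Definition bgd_hom1 : set (L -> B) := [set f |
  linear f /\ forall b c X, f (s b ∙ (t c ∙ X)) = b * f X * c].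

Definition bgd_conv1 (f g : L -> B) : L -> B :=
  fun X => \ten_(X1, X2 <- Δ X) f X1 * g X2.

Definition bgd_C1 : set (L -> B) := [set U |
  [/\ bgd_hom1 U, invertible_in bgd_hom1 bgd_conv1 ε U,
      U 1L = 1 & forall X b, U (X ∙ s b) = U (X ∙ t b)]].

Definition bgd_inv1 (U : L -> B) : L -> B := inv_in bgd_hom1 bgd_conv1 ε U.

Definition bgd_Z1 : set (L -> B) := [set U | bgd_C1 U /\ forall X Y,
  \ten_(X1, X2 <- Δ X) \ten_(Y1, Y2 <- Δ Y)
    bgd_inv1 U (X1 ∙ t (bgd_inv1 U Y1)) * U (X2 ∙ Y2) = ε (X ∙ Y)].

Definition bgd_tensBe : Type :=
  btens (fun (ab : B * B) (X : L) => X ∙ (s ab.1 ∙ t ab.2))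
        (fun (ab : B * B) (Y : L) => (s ab.1 ∙ t ab.2) ∙ Y).

HB.instance Definition _ := GRing.Lmodule.on bgd_tensBe.

Definition bepure (X Y : L) : bgd_tensBe := pure X Y.
Local Notation "X ⊠ Y" := (bepure X Y) (at level 45).

Definition bgd_hom2 : set (bgd_tensBe -> B) := [set f |
  linear f /\ forall b c X Y, f ((s b ∙ (t c ∙ X)) ⊠ Y) = b * f (X ⊠ Y) * c].

Definition bgd_conv2 (f g : bgd_tensBe -> B) : bgd_tensBe -> B :=
  fun w => \ten_(X, Y <- w)
    \ten_(X1, X2 <- Δ X) \ten_(Y1, Y2 <- Δ Y) f (X1 ⊠ Y1) * g (X2 ⊠ Y2).

Definition bgd_unit2 : bgd_tensBe -> B := fun w => \ten_(X, Y <- w) ε (X ∙ Y).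

Definition bgd_Z2 : set (bgd_tensBe -> B) := [set Γ |
  [/\ bgd_hom2 Γ, invertible_in bgd_hom2 bgd_conv2 bgd_unit2 Γ,
      forall X Y Z,
        Γ (X ⊠ \ten_(Y1, Y2 <- Δ Y) \ten_(Z1, Z2 <- Δ Z)
                 (s (Γ (Y1 ⊠ Z1)) ∙ Y2) ∙ Z2) =
        Γ ((\ten_(X1, X2 <- Δ X) \ten_(Y1, Y2 <- Δ Y)
              (s (Γ (X1 ⊠ Y1)) ∙ X2) ∙ Y2) ⊠ Z),
      forall X, Γ (1L ⊠ X) = ε X /\ Γ (X ⊠ 1L) = ε X
    & forall X Y b, Γ (X ⊠ (Y ∙ s b)) = Γ (X ⊠ (Y ∙ t b))]].

Definition bgd_act2 (Γ : bgd_tensBe -> B) (U : L -> B) : bgd_tensBe -> B :=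
  fun w => \ten_(X, Y <- w)
    \ten_(X1, X' <- Δ X) \ten_(X2, X3 <- Δ X')
    \ten_(Y1, Y' <- Δ Y) \ten_(Y2, Y3 <- Δ Y')
      bgd_inv1 U (X1 ∙ t (bgd_inv1 U Y1)) * Γ (X2 ⊠ Y2) * U (X3 ∙ Y3).

Definition bgd_H2 : set (set (bgd_tensBe -> B)) :=
  [set [set bgd_act2 Γ U | U in bgd_C1] | Γ in bgd_Z2].

End BialgebroidCohomology.

Arguments bgd_conv1 {k B} L.
Arguments bgd_counit {k B} _ _ : rename.
Arguments bgd_C1 {k B} L.
Arguments bgd_Z1 {k B} L.
Arguments bgd_Z2 {k B} L.
Arguments bgd_H2 {k B} L.

Section HopfCohomology.
Variables (k : fieldType) (H : hopfAlgType k) (B : modAlgType H).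

Local Notation Δ := (@comul k H).
Local Notation ε := (@counit k H).

Definition hopf_hom1 : set (H -> B) := [set f | linear f].

Definition hopf_conv1 (f g : H -> B) : H -> B :=
  fun h => \ten_(h1, h2 <- Δ h) f h1 * g h2.

Definition hopf_unit1 : H -> B := fun h => ε h *: 1.

Definition hopf_inv1 (u : H -> B) : H -> B :=
  inv_in hopf_hom1 hopf_conv1 hopf_unit1 u.

Definition hopf_centralizing (u : H -> B) := forall (h : H) (b : B),
  \ten_(h1, h2 <- Δ h) (h1 ▷ b) * u h2 = \ten_(h1, h2 <- Δ h) u h1 * (h2 ▷ b).

Definition hopf_Z1 : set (H -> B) := [set u |
  [/\ linear u, u 1 = 1,
      forall h g, u (h * g) = \ten_(h1, h2 <- Δ h) (h1 ▷ u g) * u h2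
    & hopf_centralizing u]].

Definition hopf_C1 : set (H -> B) := [set u |
  [/\ linear u, u 1 = 1,
      invertible_in hopf_hom1 hopf_conv1 hopf_unit1 u & hopf_centralizing u]].

Definition hopf_hom2 : set (tens H H -> B) := [set f | linear f].

Definition hopf_conv2 (f g : tens H H -> B) : tens H H -> B :=
  fun w => \ten_(h, h' <- w)
    \ten_(h1, h2 <- Δ h) \ten_(h1', h2' <- Δ h') f (h1 ⊗ h1') * g (h2 ⊗ h2').

Definition hopf_unit2 : tens H H -> B :=
  fun w => \ten_(h, g <- w) (ε h * ε g) *: 1.

Definition hopf_Z2 : set (tens H H -> B) := [set γ |
  [/\ linear γ, invertible_in hopf_hom2 hopf_conv2 hopf_unit2 γ,
      forall h : H, γ (h ⊗ 1) = ε h *: 1 /\ γ (1 ⊗ h) = ε h *: 1,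
      forall h g f : H,
        \ten_(h1, h2 <- Δ h) \ten_(g1, g2 <- Δ g) \ten_(f1, f2 <- Δ f)
          (h1 ▷ γ (g1 ⊗ f1)) * γ (h2 ⊗ (g2 * f2)) =
        \ten_(h1, h2 <- Δ h) \ten_(g1, g2 <- Δ g)
          γ (h1 ⊗ g1) * γ ((h2 * g2) ⊗ f)
    & forall (h g : H) (b : B),
        \ten_(h1, h2 <- Δ h) \ten_(g1, g2 <- Δ g)
          γ (h1 ⊗ g1) * ((h2 * g2) ▷ b) =
        \ten_(h1, h2 <- Δ h) \ten_(g1, g2 <- Δ g)
          ((h1 * g1) ▷ b) * γ (h2 ⊗ g2)]].

Definition hopf_act2 (γ : tens H H -> B) (u : H -> B) : tens H H -> B :=
  fun w => \ten_(h, g <- w)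
    \ten_(h1, h' <- Δ h) \ten_(h2, h'' <- Δ h') \ten_(h3, h4 <- Δ h'')
    \ten_(g1, g' <- Δ g) \ten_(g2, g3 <- Δ g')
      hopf_inv1 u h1 * (h2 ▷ hopf_inv1 u g1) * γ (h3 ⊗ g2) * u (h4 * g3).

Definition hopf_H2 : set (set (tens H H -> B)) :=
  [set [set hopf_act2 γ u | u in hopf_C1] | γ in hopf_Z2].

End HopfCohomology.

Arguments hopf_conv1 {k} H B.
Arguments hopf_unit1 {k} H B.
Arguments hopf_C1 {k} H B.
Arguments hopf_Z1 {k} H B.
Arguments hopf_Z2 {k} H B.
Arguments hopf_H2 {k} H B.

Section SmashBe.
Variables (k : fieldType) (H : hopfAlgType k) (B : modAlgType H).

Local Notation Δ := (@comul k H).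
Local Notation S := (@antipode k H).

Definition BeH : Type := tens B (tens B H).
HB.instance Definition _ := GRing.Lmodule.on BeH.

Definition BeH_mk (b b' : B) (h : H) : BeH := b ⊗ (b' ⊗ h).

Definition BeH_mul (X Y : BeH) : BeH :=
  \ten_(b, b'h <- X) \ten_(b', h <- b'h)
  \ten_(c, c'g <- Y) \ten_(c', g <- c'g)
  \ten_(h1, h2 <- Δ h) \ten_(g1, g2 <- Δ g)
    BeH_mk (b * (h1 ▷ c)) (c' * (S g2 ▷ b')) (h2 * g1).

Definition BeH_one : BeH := BeH_mk 1 1 1.
Definition BeH_src (b : B) : BeH := BeH_mk b 1 1.
Definition BeH_tgt (b : B) : BeH := BeH_mk 1 b 1.

Definition BeH_comul (X : BeH) :
    btens (fun b X => BeH_mul (BeH_tgt b) X) (fun b Y => BeH_mul (BeH_src b) Y) :=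
  \ten_(b, b'h <- X) \ten_(b', h <- b'h) \ten_(h1, h2 <- Δ h)
    pure (BeH_mk b 1 h1) (BeH_mk 1 b' h2).

Definition BeH_counit (X : BeH) : B :=
  \ten_(b, b'h <- X) \ten_(b', h <- b'h) b * (h ▷ b').

Definition BeH_bialgebroid : bialgebroid_ops B :=
  BialgebroidOps BeH_one BeH_comul BeH_counit.

End SmashBe.
Arguments BeH_bialgebroid {k H} B.

(* Main.v *)
Require Import Defs.
From HB Require Import structures.
From mathcomp Require Import all_boot all_order all_algebra.
From mathcomp Require Import boolp classical_sets functions.

(** A cochain of the Hopf algebroid [L = B^e # H] is determined by its values on
    the elements [1 ⊗ 1 # h], because these generate [L] as a [B]-bimodule; the
    point is to see that all the structure carries over to these values.

    Both sides are compared inside iterated convolution algebras. For an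
    algebra [A], let [conv H A] be the algebra of linear maps [H -> A] under
    convolution. One-cochains live in [R1 = conv H B] and two-cochains in
    [R2 = conv H R1], where [γ g h] stands for the value γ(h, g), and the
    cocycle condition for [γ] is an equation in [conv H R2]. All terms that
    occur in the definitions are images under four algebra maps:
    - [conv_act], written [α : B -> R1], with [α b h = h ▷ b];
    - [conv_cst], written [ι : A -> conv H A], with [ι a h = ε h *: a];
    - [conv_pullmul], written [M : conv H A -> conv H (conv H A)], with
      [M f h g = f (g * h)];
    - [conv_map φ : conv H A -> conv H A'], post-composition with [φ].
    For example [u] is centralizing when it commutes with every [α b], it is a
    one-cocycle when [M u = conv_map α u * ι u], and the action of [u] on [γ]
    is [ι v * conv_map α v * γ * M u], where [v] is the inverse of [u]. So the sets of cochains and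
    cocycles are cut out by equations in rings ([conv_C1], [conv_Z1],
    [conv_Z2]), and manipulations of Sweedler indices become associativity.

    On the side of [H] this is a rewriting of the definitions. The only fact
    with content is that a unital centralizing [u] satisfying the one-cocycle
    equation is convolution invertible ([conv_Z1_invertible]).

    On the side of [L], put [stH b d h = s(b) t(d) (1 ⊗ 1 # h)]. These elements
    multiply and comultiply without the antipode ([stHM], [comul_stH]), every
    trilinear function of [(b, d, h)] extends uniquely to [L] ([ext_stHE],
    [stH_ext]), and bimodule maps are read off at once. A bimodule map [L -> B]
    sends [stH b d h] to [b * u h * d] for a unique [u] in [R1]; a bimodule map
    on [L ⊗_{B^e} L] sends the class of [stH b d h] and [stH c e g] to
    [b * (α c * γ g * α e) h * d] for a unique [γ] in [R2]; and convolution is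
    the product of [R1] and [R2] ([bgd_represents1], [bgd_represents2]).
    The maps [U(X Y)] and, for [V] inverse to [U] in C^1, [V(X t(V(Y)))] are
    the two-cochains of [M u] and of [ι v * conv_map α v] ([form_mul],
    [form_tgt_cochain1]), so the one-cocycle condition and the action on
    two-cocycles are the same expressions in [R2] on both sides. The two-cocycle
    condition is evaluated in [form_twisted_r] and [form_twisted_l].

    One subtlety runs through the computations on [L]. In a double sum over
    Δ X and Δ Y, the summand need not be balanced in [Y] for a fixed term
    [X1 ⊗ X2]; it becomes so after summation over Δ X. The finite sums over
    chosen representatives are therefore exchanged before Δ Y is evaluated. *)

Set Implicit Arguments.
Unset Strict Implicit.
Unset Printing Implicit Defensive.

Import GRing.Theory.
Local Open Scope quotient_scope.
Local Open Scope classical_set_scope.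
Local Open Scope ring_scope.
Local Open Scope sweedler_scope.

(** * Linear maps and balanced tensor products *)

Section LinearMaps.
Variable k : fieldType.

Lemma linear_map0 (U V : lmodType k) (f : U -> V) : linear f -> f 0 = 0.
Proof.
move=> fl; have := fl (-1) 0 0.
by rewrite scaleN1r oppr0 addr0 scaleN1r addNr.
Qed.

Lemma linear_mapZ (U V : lmodType k) (f : U -> V) c x :
  linear f -> f (c *: x) = c *: f x.
Proof. by move=> fl; have := fl c x 0; rewrite (linear_map0 fl) !addr0. Qed.

Lemma linear_idfun (V : lmodType k) : linear (fun x : V => x).
Proof. by []. Qed.

Lemma linear_comp (U V W : lmodType k) (f : V -> W) (g : U -> V) :
  linear f -> linear g -> linear (fun x => f (g x)).
Proof. by move=> fl gl c x y; rewrite gl fl. Qed.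

Lemma linear_mull (A : algType k) (a : A) : linear (fun x : A => a * x).
Proof. by move=> c x y; rewrite mulrDr scalerAr. Qed.

Lemma linear_mulr (A : algType k) (a : A) : linear (fun x : A => x * a).
Proof. by move=> c x y; rewrite mulrDl scalerAl. Qed.

Lemma linear_counit (H : hopfAlgType k) (V W : lmodType k) (g : W -> H) (v : V) :
  linear g -> linear (fun x => counit (g x) *: v).
Proof. by move=> gl c x y; rewrite gl counit_linear scalerDl scalerA. Qed.

End LinearMaps.

Section TensorSums.
Variables (k : fieldType) (U V : lmodType k) (A : Type).
Variables (ra : A -> U -> U) (la : A -> V -> V).
Implicit Types w : btens ra la.

Definition balanced (W : lmodType k) (F : U -> V -> W) :=
  [/\ forall v, linear (F ^~ v), forall u, linear (F u)
    & forall a u v, F (ra a u) v = F u (la a v)].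

Lemma linear_tsum_bal (W : lmodType k) (F : U -> V -> W) :
  balanced F -> linear (fun w => tsum w F).
Proof.
move=> [Fl Fr Fb] c; elim/quotW=> s; elim/quotW=> t.
have -> : c *: \pi_(btens ra la) s + \pi_(btens ra la) t
    = \pi_(btens ra la) (fsum_scale c s ++ t).
  by rewrite -btens_addE -btens_scaleE.
rewrite !tsum_pi // big_cat big_map /= scaler_sumr; congr (_ + _).
by apply: eq_bigr => p _; rewrite (linear_mapZ _ _ (Fl _)).
Qed.

Lemma tsum_pureE (W : lmodType k) (F : U -> V -> W) u v :
  balanced F -> tsum (pure u v : btens ra la) F = F u v.
Proof. by case=> *; apply: tsum_pure. Qed.

Lemma pi_sum (s : seq (U * V)) :
  \pi_(btens ra la) s = \sum_(p <- s) (pure p.1 p.2 : btens ra la).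
Proof.
elim: s => [|[u v] s IH]; first by rewrite big_nil.
by rewrite big_cons -IH -[RHS]/(btens_add _ _) /pure btens_addE.
Qed.

Lemma balanced_pure : balanced (fun u v => pure u v : btens ra la).
Proof.
split=> [v c u u'|u c v v'|a u v]; last exact/btens_eqP/TR_bal.
- rewrite -[RHS]/(btens_add (btens_scale _ _) _) /pure btens_scaleE btens_addE.
  exact/btens_eqP/TR_addl.
- rewrite -[RHS]/(btens_add (btens_scale _ _) _) /pure btens_scaleE btens_addE.
  apply/btens_eqP; apply: TR_trans (TR_addr _ _ _ _ _) _.
  apply: (TR_cat (s := [:: _]) (s' := [:: _])); last exact: TR_refl.
  exact/TR_sym/TR_scal.
Qed.

Lemma linear_purel v : linear (fun u => pure u v : btens ra la).
Proof. by case: balanced_pure => + _ _; apply. Qed.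

Lemma linear_purer u : linear (fun v => pure u v : btens ra la).
Proof. by case: balanced_pure => _ + _; apply. Qed.

(** The chosen representative of [w] is a formal sum of pure tensors, and [w] is
    the sum of their classes; hence linear maps are determined by their values
    on pure tensors. *)
Lemma tsum_repr (W : lmodType k) (f : btens ra la -> W) w :
  linear f -> tsum w (fun u v => f (pure u v)) = f w.
Proof.
move=> fl; pose f' := HB.pack_for {linear btens ra la -> W} f
  (GRing.isLinear.Build _ _ _ _ f fl).
rewrite /tsum -[in RHS](reprK w) pi_sum -[f]/(f' : _ -> _) raddf_sum.
by apply: eq_bigr.
Qed.

Lemma btens_ext (W : lmodType k) (f g : btens ra la -> W) :
  linear f -> linear g -> (forall u v, f (pure u v) = g (pure u v)) -> f =1 g.
Proof.
move=> fl gl fg w; rewrite -(tsum_repr _ fl) -(tsum_repr _ gl).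
by apply: eq_bigr => p _; rewrite fg.
Qed.

Lemma eq_tsum (W : nmodType) (F G : U -> V -> W) w :
  (forall u v, F u v = G u v) -> tsum w F = tsum w G.
Proof. by move=> FG; apply: eq_bigr. Qed.

(** As [w] is fixed, so is its chosen representative, and the sum is a finite sum
    of linear maps. *)
Lemma linear_tsum_param (Z W : lmodType k) (F : Z -> U -> V -> W) w :
  (forall u v, linear (fun z => F z u v)) -> linear (fun z => tsum w (F z)).
Proof.
move=> Fl c x y; rewrite /tsum scaler_sumr -big_split.
by apply: eq_bigr => p _; rewrite /= Fl.
Qed.

Lemma linear_of_tsum (W W' : lmodType k) (f : W -> W') w (F : U -> V -> W) :
  linear f -> f (tsum w F) = tsum w (fun u v => f (F u v)).
Proof.
move=> fl; pose f' := HB.pack_for {linear W -> W'} f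
  (GRing.isLinear.Build _ _ _ _ f fl).
by rewrite -[f]/(f' : _ -> _) raddf_sum.
Qed.

Lemma tsum_mull (R : pzRingType) (a : R) w (F : U -> V -> R) :
  a * tsum w F = tsum w (fun u v => a * F u v).
Proof. exact: mulr_sumr. Qed.

Lemma tsum_mulr (R : pzRingType) (a : R) w (F : U -> V -> R) :
  tsum w F * a = tsum w (fun u v => F u v * a).
Proof. exact: mulr_suml. Qed.

(** Both sides are double sums over the same two finite sequences, the chosen
    representatives of [w] and [w']. *)
Lemma tsum_exchange (U' V' : lmodType k) (A' : Type) (ra' : A' -> U' -> U')
    (la' : A' -> V' -> V') (W : nmodType) w (w' : btens ra' la')
    (F : U -> V -> U' -> V' -> W) :
  tsum w (fun u v => tsum w' (F u v)) =
  tsum w' (fun u' v' => tsum w (fun u v => F u v u' v')).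
Proof. exact: exchange_big. Qed.

End TensorSums.

Section TensorProduct.
Variables (k : fieldType) (U V : lmodType k).

Lemma bilinear_balanced (W : lmodType k) (F : U -> V -> W) :
  (forall v, linear (F ^~ v)) -> (forall u, linear (F u)) ->
  balanced (fun c : k => GRing.scale c) (fun c : k => GRing.scale c) F.
Proof.
move=> Fl Fr; split=> // c u v.
by rewrite (linear_mapZ _ _ (Fl v)) (linear_mapZ _ _ (Fr u)).
Qed.

Lemma linear_tsum (W : lmodType k) (F : U -> V -> W) :
  (forall v, linear (F ^~ v)) -> (forall u, linear (F u)) ->
  linear (fun w : tens U V => tsum w F).
Proof. by move=> Fl Fr; apply/linear_tsum_bal/bilinear_balanced. Qed.

Lemma tsum_tpure (W : lmodType k) (F : U -> V -> W) u v :
  (forall v, linear (F ^~ v)) -> (forall u, linear (F u)) ->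
  tsum (u ⊗ v) F = F u v.
Proof. by move=> Fl Fr; apply/tsum_pureE/bilinear_balanced. Qed.

Lemma linear_tpurel (v : V) : linear (fun u : U => u ⊗ v).
Proof. exact: linear_purel. Qed.

Lemma linear_tpurer (u : U) : linear (fun v : V => u ⊗ v).
Proof. exact: linear_purer. Qed.

End TensorProduct.

(** Side conditions of the form [linear (fun x => E)] are solved by descending
    along the unique occurrence of [x] in [E]: a sum is linear in its summand,
    and linear in its tensor when the summand is bilinear; any other expression
    is peeled one function at a time. The hints list the functions that are
    linear in one of their arguments. *)
Create HintDb linear.
#[local] Hint Extern 0 (GRing.linear_for _ _) => (apply: linear_mull) : linear.
#[local] Hint Extern 0 (GRing.linear_for _ _) => (apply: linear_mulr) : linear.
#[local] Hint Extern 0 (GRing.linear_for _ _) => (apply: hact_linearl) : linear.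
#[local] Hint Extern 0 (GRing.linear_for _ _) => (apply: hact_linearr) : linear.
#[local] Hint Extern 0 (GRing.linear_for _ _) => (apply: comul_linear) : linear.
#[local] Hint Extern 0 (GRing.linear_for _ _) => (apply: antipode_linear) : linear.
#[local] Hint Extern 0 (GRing.linear_for _ _) => (apply: linear_purel) : linear.
#[local] Hint Extern 0 (GRing.linear_for _ _) => (apply: linear_purer) : linear.
#[local] Hint Extern 0 (GRing.linear_for _ _) => (apply: linear_tpurel) : linear.
#[local] Hint Extern 0 (GRing.linear_for _ _) => (apply: linear_tpurer) : linear.
#[local] Hint Extern 0 (GRing.linear_for _ _) => (apply: linearP) : linear.

Ltac linear_base := solve [auto 1 with nocore linear].
Ltac linear_hyp := solve [match goal with Hl : _ |- _ => apply: Hl end].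

Ltac linear_step :=
  lazymatch goal with
  | |- GRing.linear_for _ (fun x => x) => apply: linear_idfun
  | |- GRing.linear_for _ (fun x => tsum _ _) => first
    [ match goal with |- GRing.linear_for _ (fun x => tsum ?w (@?F x)) =>
        apply: (linear_tsum_param w (F := F)) => ? ?
      end
    | match goal with |- GRing.linear_for _ (fun x => tsum (@?w x) ?F) =>
        lazymatch type of w with _ -> ?T =>
          apply: (linear_comp (f := fun z : T => tsum z F) (g := w))
        end; [apply: linear_tsum | ]
      end ]
  | |- GRing.linear_for _ (fun x => counit (@?g x) *: ?v) =>
    apply: linear_counit
  | |- GRing.linear_for _ _ => first
    [ linear_base
    | linear_hyp
    | multimatch goal with
      | |- GRing.linear_for _ (fun x => ?f (@?g x)) =>
        apply: (linear_comp (f := fun y => f y) (g := g))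
      | |- GRing.linear_for _ (fun x => ?f (@?g x) ?b) =>
        apply: (linear_comp (f := fun y => f y b) (g := g))
      | |- GRing.linear_for _ (fun x => ?f (@?g x) ?b ?c) =>
        apply: (linear_comp (f := fun y => f y b c) (g := g))
      end; [solve [linear_base | linear_hyp] | ] ]
  | |- _ => move=> ?
  end.
Ltac linearity := repeat (cbv beta; linear_step).

(** * Convolution algebras *)

Section Convolution.
Variables (k : fieldType) (H : hopfAlgType k).
Local Notation Δ := (@comul k H).
Local Notation ε := (@counit k H).

Record conv (A : algType k) := Conv { conv_fun :> H -> A; convP : linear conv_fun }.

HB.instance Definition _ A := gen_eqMixin (conv A).
HB.instance Definition _ A := gen_choiceMixin (conv A).

Lemma convE A (f g : conv A) : f =1 g -> f = g.
Proof.
case: f g => [f fl] [g gl] /= /funext fg; rewrite fg in fl *.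
by congr Conv; apply: Prop_irrelevance.
Qed.

(** Coassociativity in the form used in computations: the identity of the
    comultiplication evaluated by the linear map that [T] induces on the triple
    tensor product. *)
Lemma sweedlerA (W : lmodType k) (T : H -> H -> H -> W) h :
  (forall y z, linear (fun x => T x y z)) -> (forall x z, linear (T x ^~ z)) ->
  (forall x y, linear (T x y)) ->
  \ten_(h', h3 <- Δ h) \ten_(h1, h2 <- Δ h') T h1 h2 h3 =
  \ten_(h1, h' <- Δ h) \ten_(h2, h3 <- Δ h') T h1 h2 h3.
Proof.
move=> T1 T2 T3.
pose G (w : tens H (tens H H)) := \ten_(x, yz <- w) \ten_(y, z <- yz) T x y z.
have Gl : linear G by rewrite /G; linearity.
have GE x y z : G (x ⊗ (y ⊗ z)) = T x y z.
  by rewrite /G !tsum_tpure //; linearity.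
have := congr1 G (comulA h); rewrite !linear_of_tsum //.
under eq_tsum => ? ? do (rewrite linear_of_tsum //; under eq_tsum do rewrite GE).
under [in X in _ = X -> _]eq_tsum => ? ? do
  (rewrite linear_of_tsum //; under eq_tsum do rewrite GE).
by [].
Qed.

Section ConvAlgebra.
Variable A : algType k.
Implicit Types f g : conv A.

Fact conv_zero_linear : linear (fun _ : H => 0 : A).
Proof. by move=> c x y; rewrite scaler0 addr0. Qed.
Fact conv_add_linear f g : linear (fun x => f x + g x).
Proof. by move=> c x y; rewrite !convP scalerDr addrACA. Qed.
Fact conv_opp_linear f : linear (fun x => - f x).
Proof. by move=> c x y; rewrite convP opprD scalerN. Qed.
Fact conv_scale_linear c f : linear (fun x => c *: f x).
Proof. by move=> d x y; rewrite convP scalerDr !scalerA mulrC. Qed.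
Fact conv_one_linear : linear (fun x : H => ε x *: (1 : A)).
Proof. by linearity. Qed.
Fact conv_mul_linear f g : linear (fun x => \ten_(y, z <- Δ x) f y * g z).
Proof. by have := convP f; have := convP g; linearity. Qed.

Definition conv_zero := Conv conv_zero_linear.
Definition conv_add f g := Conv (conv_add_linear f g).
Definition conv_opp f := Conv (conv_opp_linear f).
Definition conv_scale c f := Conv (conv_scale_linear c f).
Definition conv_one := Conv conv_one_linear.
Definition conv_mul f g := Conv (conv_mul_linear f g).

Fact conv_addA : associative conv_add.
Proof. by move=> f g h; apply: convE => x /=; rewrite addrA. Qed.
Fact conv_addC : commutative conv_add.
Proof. by move=> f g; apply: convE => x /=; rewrite addrC. Qed.
Fact conv_add0 : left_id conv_zero conv_add.
Proof. by move=> f; apply: convE => x /=; rewrite add0r. Qed.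
Fact conv_addN : left_inverse conv_zero conv_opp conv_add.
Proof. by move=> f; apply: convE => x /=; rewrite addNr. Qed.

HB.instance Definition _ :=
  GRing.isZmodule.Build (conv A) conv_addA conv_addC conv_add0 conv_addN.

Fact conv_scaleA c d f : conv_scale c (conv_scale d f) = conv_scale (c * d) f.
Proof. by apply: convE => x /=; rewrite scalerA. Qed.
Fact conv_scale1 : left_id 1 conv_scale.
Proof. by move=> f; apply: convE => x /=; rewrite scale1r. Qed.
Fact conv_scaleDr : right_distributive conv_scale +%R.
Proof. by move=> c f g; apply: convE => x /=; rewrite scalerDr. Qed.
Fact conv_scaleDl f c d : conv_scale (c + d) f = conv_scale c f + conv_scale d f.
Proof. by apply: convE => x /=; rewrite scalerDl. Qed.

HB.instance Definition _ := GRing.Zmodule_isLmodule.Build k (conv A)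
  conv_scaleA conv_scale1 conv_scaleDr conv_scaleDl.

Fact conv_mulA : associative conv_mul.
Proof.
move=> f g h; apply: convE => x /=.
have fl := convP f; have gl := convP g; have hl := convP h.
under eq_tsum do rewrite tsum_mull; under [RHS]eq_tsum do rewrite tsum_mulr.
rewrite (sweedlerA (T := fun x y z => f x * g y * h z)); try by linearity.
by do 2 apply: eq_tsum => ? ?; rewrite mulrA.
Qed.
Fact conv_mul1 : left_id conv_one conv_mul.
Proof.
move=> f; apply: convE => x /=.
under eq_tsum do rewrite -scalerAl mul1r.
rewrite -[in RHS](counitl x) linear_of_tsum; last exact: convP.
by apply: eq_tsum => y z; rewrite linear_mapZ //; apply: convP.
Qed.
Fact conv_1mul : right_id conv_one conv_mul.
Proof.
move=> f; apply: convE => x /=.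
under eq_tsum do rewrite -scalerAr mulr1.
rewrite -[in RHS](counitr x) linear_of_tsum; last exact: convP.
by apply: eq_tsum => y z; rewrite linear_mapZ //; apply: convP.
Qed.
Fact conv_mulDl : left_distributive conv_mul +%R.
Proof.
move=> f g h; apply: convE => x; rewrite /= /tsum -big_split.
by apply: eq_bigr => p _ /=; rewrite mulrDl.
Qed.
Fact conv_mulDr : right_distributive conv_mul +%R.
Proof.
move=> f g h; apply: convE => x; rewrite /= /tsum -big_split.
by apply: eq_bigr => p _ /=; rewrite mulrDr.
Qed.
Fact conv_one_neq0 : conv_one != 0.
Proof.
apply/eqP => /(congr1 (fun f : conv A => f 1)) /=.
by rewrite counit1 scale1r => /eqP; rewrite oner_eq0.
Qed.

HB.instance Definition _ := GRing.Zmodule_isNzRing.Build (conv A)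
  conv_mulA conv_mul1 conv_1mul conv_mulDl conv_mulDr conv_one_neq0.

Fact conv_scaleAl c f g : c *: (f * g) = c *: f * g.
Proof.
apply: convE => x; rewrite /= /tsum scaler_sumr.
by apply: eq_bigr => p _; rewrite /= scalerAl.
Qed.
Fact conv_scaleAr c f g : c *: (f * g) = f * (c *: g).
Proof.
apply: convE => x; rewrite /= /tsum scaler_sumr.
by apply: eq_bigr => p _; rewrite /= scalerAr.
Qed.

HB.instance Definition _ := GRing.Lmodule_isLalgebra.Build k (conv A) conv_scaleAl.
HB.instance Definition _ := GRing.Lalgebra_isAlgebra.Build k (conv A) conv_scaleAr.

Lemma convME f g x : (f * g) x = \ten_(y, z <- Δ x) f y * g z.
Proof. by []. Qed.
Lemma convM3E f g e x : (f * g * e) x =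
  \ten_(x1, y <- Δ x) \ten_(x2, x3 <- Δ y) f x1 * g x2 * e x3.
Proof.
rewrite -mulrA convME; apply: eq_tsum => x1 y.
by rewrite convME tsum_mull; apply: eq_tsum => x2 x3; rewrite mulrA.
Qed.
Lemma conv1E x : (1 : conv A) x = ε x *: 1.
Proof. by []. Qed.
Lemma linear_conv_eval x : linear (fun f : conv A => f x).
Proof. by []. Qed.

End ConvAlgebra.
End Convolution.

#[local] Hint Extern 0 (GRing.linear_for _ _) => (apply: convP) : linear.
#[local] Hint Extern 0 (GRing.linear_for _ _) => (apply: linear_conv_eval) : linear.

(** * Sums over coproducts *)

Section Sweedler.
Variables (k : fieldType) (H : hopfAlgType k).
Local Notation Δ := (@comul k H).
Local Notation ε := (@counit k H).
Local Notation S := (@antipode k H).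

Lemma sum_counitl (W : lmodType k) (F : H -> W) h :
  linear F -> \ten_(h1, h2 <- Δ h) ε h1 *: F h2 = F h.
Proof.
move=> Fl; rewrite -[in RHS](counitl h) linear_of_tsum //.
by apply: eq_tsum => x y; rewrite linear_mapZ.
Qed.

Lemma sum_counitr (W : lmodType k) (F : H -> W) h :
  linear F -> \ten_(h1, h2 <- Δ h) ε h2 *: F h1 = F h.
Proof.
move=> Fl; rewrite -[in RHS](counitr h) linear_of_tsum //.
by apply: eq_tsum => x y; rewrite linear_mapZ.
Qed.

Lemma sum_antipodel (W : lmodType k) (F : H -> W) h :
  linear F -> \ten_(h1, h2 <- Δ h) F (S h1 * h2) = ε h *: F 1.
Proof. by move=> Fl; rewrite -linear_of_tsum // antipodel linear_mapZ. Qed.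

Lemma sum_antipoder (W : lmodType k) (F : H -> W) h :
  linear F -> \ten_(h1, h2 <- Δ h) F (h1 * S h2) = ε h *: F 1.
Proof. by move=> Fl; rewrite -linear_of_tsum // antipoder linear_mapZ. Qed.

Lemma sum_comulM (W : lmodType k) (F : H -> H -> W) h g :
  (forall y, linear (F ^~ y)) -> (forall x, linear (F x)) ->
  \ten_(x, y <- Δ (h * g)) F x y =
  \ten_(h1, h2 <- Δ h) \ten_(g1, g2 <- Δ g) F (h1 * g1) (h2 * g2).
Proof.
move=> Fl Fr; have Tl := linear_tsum Fl Fr.
rewrite comulM (linear_of_tsum _ _ Tl); apply: eq_tsum => h1 h2.
by rewrite (linear_of_tsum _ _ Tl); apply: eq_tsum => g1 g2; rewrite tsum_tpure.
Qed.

Lemma sum_comul1 (W : lmodType k) (F : H -> H -> W) :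
  (forall y, linear (F ^~ y)) -> (forall x, linear (F x)) ->
  \ten_(x, y <- Δ 1) F x y = F 1 1.
Proof. by move=> Fl Fr; rewrite comul1 tsum_tpure. Qed.

(** The antipode reverses the comultiplication: [S h2 ⊗ S h1] is obtained from
    Δ(S h1) by multiplying with [h2 S(h5) ⊗ h3 S(h4)], which is trivial by the
    antipode axiom, and then collapsing [S(h1) h2] under Δ. *)
Lemma sum_comul_antipode (W : lmodType k) (T : H -> H -> W) h :
  (forall y, linear (T ^~ y)) -> (forall x, linear (T x)) ->
  \ten_(x, y <- Δ (S h)) T x y = \ten_(h1, h2 <- Δ h) T (S h2) (S h1).
Proof.
move=> Tl Tr.
(* The inserted factor, with its value [KE] by the antipode axiom. *)
pose K x y r := \ten_(b, c <- Δ r) \ten_(b1, b2 <- Δ b) \ten_(c1, c2 <- Δ c)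
  T (x * b1 * S c2) (y * b2 * S c1).
have KE x y r : K x y r = ε r *: T x y.
  rewrite /K (sweedlerA (T := fun b1 b2 c => \ten_(c1, c2 <- Δ c)
    T (x * b1 * S c2) (y * b2 * S c1))); try by linearity.
  under eq_tsum => b1 s.
    rewrite -(sweedlerA (T := fun b2 c1 c2 =>
      T (x * b1 * S c2) (y * b2 * S c1))); try by linearity.
    under eq_tsum => e c2.
      under eq_tsum do rewrite -(mulrA y).
      rewrite (sum_antipoder (F := fun z => T (x * b1 * S c2) (y * z))) ?mulr1;
        last by linearity.
      over.
    rewrite (sum_counitl (F := fun c2 => T (x * b1 * S c2) y)); last by linearity.
    over.
  under eq_tsum do rewrite -mulrA.
  by rewrite (sum_antipoder (F := fun z => T (x * z) y)) ?mulr1 //; linearity.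
transitivity (\ten_(a, r <- Δ h) \ten_(x, y <- Δ (S a)) K x y r).
  under [RHS]eq_tsum => a r do under eq_tsum do rewrite KE.
  pose G z := \ten_(x, y <- Δ (S z)) T x y.
  have Gl : linear G by rewrite /G; linearity.
  rewrite -[LHS]/(G h) -[in LHS](counitr h) (linear_of_tsum _ _ Gl).
  by apply: eq_tsum => a r; rewrite (linear_mapZ _ _ Gl) /tsum scaler_sumr.
transitivity (\ten_(p, c <- Δ h) \ten_(a, b <- Δ p)
   \ten_(x, y <- Δ (S a * b)) \ten_(c1, c2 <- Δ c) T (x * S c2) (y * S c1)).
  rewrite (sweedlerA (T := fun a b c => \ten_(x, y <- Δ (S a * b))
    \ten_(c1, c2 <- Δ c) T (x * S c2) (y * S c1))); try by linearity.
  apply: eq_tsum => a r; rewrite tsum_exchange; apply: eq_tsum => b c.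
  by rewrite sum_comulM //; linearity.
under eq_tsum => p c.
  rewrite (sum_antipodel (F := fun z => \ten_(x, y <- Δ z) \ten_(c1, c2 <- Δ c)
    T (x * S c2) (y * S c1))); last by linearity.
  rewrite sum_comul1; try by linearity.
  under eq_tsum do rewrite !mul1r.
  over.
by rewrite (sum_counitl (F := fun c => \ten_(c1, c2 <- Δ c) T (S c2) (S c1)));
  linearity.
Qed.

End Sweedler.

(** * Algebra maps between convolution algebras *)

Section StructureMaps.
Variables (k : fieldType) (H : hopfAlgType k).
Local Notation conv := (conv H).

Section Generic.
Variable A : algType k.

Definition conv_cst (a : A) : conv A :=
  Conv (linear_counit a (@linear_idfun _ H)).

Fact conv_cst_linear : linear conv_cst.
Proof. by move=> c a b; apply: convE => h /=; rewrite scalerDr !scalerA mulrC. Qed.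

Lemma conv_cst_mull a (f : conv A) h : (conv_cst a * f) h = a * f h.
Proof.
rewrite convME /=; under eq_tsum do rewrite -scalerAl.
by rewrite (sum_counitl (F := fun h => a * f h)) //; linearity.
Qed.

Lemma conv_cst_mulr a (f : conv A) h : (f * conv_cst a) h = f h * a.
Proof.
rewrite convME /=; under eq_tsum do rewrite -scalerAr.
by rewrite (sum_counitr (F := fun h => f h * a)) //; linearity.
Qed.

Fact conv_cst_monoid_morphism : monoid_morphism conv_cst.
Proof.
split=> [|a b]; first exact: convE.
by apply: convE => h; rewrite conv_cst_mull /= -scalerAr.
Qed.

HB.instance Definition _ := GRing.isLinear.Build _ _ _ _ conv_cst conv_cst_linear.
HB.instance Definition _ :=
  GRing.isMonoidMorphism.Build _ _ conv_cst conv_cst_monoid_morphism.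

Fact conv_pullmulr_linear (f : conv A) h : linear (fun g => f (g * h)).
Proof. by linearity. Qed.

(** The dual of the multiplication of [H], in curried form. *)
Definition conv_pullmulr f h := Conv (conv_pullmulr_linear f h).

Fact conv_pullmul_linear f : linear (conv_pullmulr f).
Proof. by move=> c x y; apply: convE => h /=; rewrite mulrDr -scalerAr convP. Qed.

Definition conv_pullmul f : conv (conv A) := Conv (conv_pullmul_linear f).

Lemma conv_pullmulE f h g : conv_pullmul f h g = f (g * h).
Proof. by []. Qed.

Fact conv_pullmul_is_linear : linear conv_pullmul.
Proof. by move=> c f g; apply: convE => h; apply: convE. Qed.

Fact conv_pullmul_monoid_morphism : monoid_morphism conv_pullmul.
Proof.
split=> [|f g]; apply: convE => h; apply: convE => x.
  by rewrite /= counitM scalerA mulrC.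
rewrite conv_pullmulE convME.
rewrite (sum_comulM (F := fun y z => f y * g z)); try by linearity.
rewrite tsum_exchange convME.
by rewrite (linear_of_tsum (f := fun f => conv_fun f x)).
Qed.

HB.instance Definition _ :=
  GRing.isLinear.Build _ _ _ _ conv_pullmul conv_pullmul_is_linear.
HB.instance Definition _ :=
  GRing.isMonoidMorphism.Build _ _ conv_pullmul conv_pullmul_monoid_morphism.

End Generic.

Section Map.
Variables (A A' : algType k) (phi : {lrmorphism A -> A'}).

Definition conv_map (f : conv A) : conv A' :=
  Conv (linear_comp (f := phi) (@linearP _ _ _ _ phi) (convP f)).

Fact conv_map_linear : linear conv_map.
Proof. by move=> c f g; apply: convE => h; rewrite /= linearP. Qed.

Fact conv_map_monoid_morphism : monoid_morphism conv_map.
Proof.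
split=> [|f g]; apply: convE => h; first by rewrite /= linearZ rmorph1.
rewrite convME [LHS]/= /tsum raddf_sum.
by apply: eq_bigr => p _; apply: rmorphM.
Qed.

HB.instance Definition _ := GRing.isLinear.Build _ _ _ _ conv_map conv_map_linear.
HB.instance Definition _ :=
  GRing.isMonoidMorphism.Build _ _ conv_map conv_map_monoid_morphism.

End Map.

Section Action.
Variable B : modAlgType H.

Definition conv_act (b : B) : conv B := Conv (@hact_linearl k H B b).

Lemma conv_actE b h : conv_act b h = h ▷ b.
Proof. by []. Qed.

Fact conv_act_linear : linear conv_act.
Proof. by move=> c a b; apply: convE => h; apply: hact_linearr. Qed.

Fact conv_act_monoid_morphism : monoid_morphism conv_act.
Proof.
split=> [|a b]; apply: convE => h; first exact: hact_one.
exact: hactM.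
Qed.

HB.instance Definition _ := GRing.isLinear.Build _ _ _ _ conv_act conv_act_linear.
HB.instance Definition _ :=
  GRing.isMonoidMorphism.Build _ _ conv_act conv_act_monoid_morphism.

(** Two ways of letting a product [h * g] act on [b]; the coherence between [α]
    and [M] that makes the two sides of the centralizing condition agree. *)
Lemma conv_pullmul_act b :
  conv_pullmul (conv_act b) = conv_map conv_act (conv_act b).
Proof. by apply: convE => g; apply: convE => h; apply: hactA. Qed.

End Action.
End StructureMaps.

(** * Cochains and cocycles in convolution algebras *)

Section HopfCochains.
Variables (k : fieldType) (H : hopfAlgType k) (B : modAlgType H).
Local Notation Δ := (@comul k H).
Local Notation ε := (@counit k H).
Local Notation S := (@antipode k H).
Local Notation R1 := (conv H B).
Local Notation R2 := (conv H R1).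
Local Notation α := (@conv_act k H B).
Local Notation ι := (@conv_cst k H _).
Local Notation M := (@conv_pullmul k H _).

Definition conv_C1 : set R1 := [set u : R1 |
  [/\ u 1 = 1, exists v, u * v = 1 /\ v * u = 1 & forall b, α b * u = u * α b]].

Definition conv_Z1 : set R1 := [set u : R1 | conv_C1 u /\ M u = conv_map α u * ι u].

(** With [γ g h] for γ(h, g), the four terms of the cocycle condition at
    (h, g, f) are [conv_map (conv_map α) γ] for h ▷ γ(g, f), [M γ] for γ(h, gf),
    [ι γ] for γ(h, g) and [conv_map M γ] for γ(hg, f). *)
Definition conv_Z2 : set R2 := [set γ : R2 |
  [/\ exists δ, γ * δ = 1 /\ δ * γ = 1,
      γ 1 = 1 /\ forall h, γ h 1 = ε h *: 1,
      conv_map (conv_map α) γ * M γ = ι γ * conv_map M γ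
    & forall b, γ * conv_map α (α b) = conv_map α (α b) * γ]].

Lemma conv_eval1 (u v : R1) : (u * v) 1 = u 1 * v 1.
Proof. by rewrite convME sum_comul1 //; linearity. Qed.

Lemma conv_C1_1 : conv_C1 1.
Proof.
split; first by rewrite conv1E counit1 scale1r.
  by exists 1; rewrite mulr1.
by move=> b; rewrite mulr1 mul1r.
Qed.

Lemma conv_C1M u v : conv_C1 u -> conv_C1 v -> conv_C1 (u * v).
Proof.
case=> u1 [u' [uu' u'u]] uc [v1 [v' [vv' v'v]] vc]; split.
- by rewrite conv_eval1 u1 v1 mulr1.
- exists (v' * u'); split.
    by rewrite mulrA -(mulrA u) vv' mulr1 uu'.
  by rewrite mulrA -(mulrA v') u'u mulr1 v'v.
- by move=> b; rewrite mulrA uc -!mulrA vc.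
Qed.

Lemma conv_C1V u v : conv_C1 u -> u * v = 1 -> v * u = 1 -> conv_C1 v.
Proof.
case=> u1 _ uc uv vu; split; last 1 first.
- move=> b; rewrite -[LHS]mul1r -vu -!mulrA; congr (_ * _).
  by rewrite mulrA -uc -mulrA uv mulr1.
- by rewrite -[LHS]mul1r -u1 -conv_eval1 uv conv1E counit1 scale1r.
- by exists u.
Qed.

(** At [g] this says that [u] commutes with [α (w g)]: it is what makes products
    and inverses of one-cocycles one-cocycles. *)
Lemma conv_C1_comm (u w : R1) : conv_C1 u -> ι u * conv_map α w = conv_map α w * ι u.
Proof.
by case=> _ _ uc; apply: convE => g; rewrite conv_cst_mull conv_cst_mulr /= uc.
Qed.

Lemma conv_Z1_1 : conv_Z1 1.
Proof. by split; [exact: conv_C1_1 | rewrite !rmorph1 mulr1]. Qed.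

Lemma conv_Z1M u v : conv_Z1 u -> conv_Z1 v -> conv_Z1 (u * v).
Proof.
case=> uC Mu [vC Mv]; split; first exact: conv_C1M.
rewrite !rmorphM /= Mu Mv !mulrA; congr (_ * _).
by rewrite -!mulrA (conv_C1_comm v uC).
Qed.

Lemma conv_Z1V u v : conv_Z1 u -> u * v = 1 -> v * u = 1 -> conv_Z1 v.
Proof.
case=> uC Mu uv vu; have vC := conv_C1V uC uv vu; split=> //.
rewrite -(conv_C1_comm v vC) -[LHS]mulr1.
have -> : 1 = M u * (ι v * conv_map α v) :> R2.
  rewrite Mu mulrA -(mulrA (conv_map _ _)) -rmorphM uv rmorph1 mulr1.
  by rewrite -rmorphM uv rmorph1.
by rewrite mulrA -rmorphM vu rmorph1 mul1r.
Qed.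

(** [ι v * conv_map α v] is the inverse of [conv_map α u * ι u] in [R2]. *)
Lemma conv_Z1P (u v : R1) : conv_C1 u -> u * v = 1 -> v * u = 1 ->
  M u = conv_map α u * ι u <-> ι v * conv_map α v * M u = 1.
Proof.
move=> uC uv vu; split=> [->|E].
  rewrite mulrA -(mulrA (ι v)) -rmorphM vu rmorph1 mulr1.
  by rewrite -rmorphM vu rmorph1.
rewrite -[RHS]mulr1 -E !mulrA -(mulrA (conv_map α u)) -rmorphM uv rmorph1.
by rewrite mulr1 -rmorphM uv rmorph1 mul1r.
Qed.

(** The inverse is h ↦ h1 ▷ u(S h2). Multiplying it by [u] on the left gives
    u(h1 S(h2)) after the centralizing and cocycle conditions, and on the right
    h1 ▷ u(S(h2) h3); both collapse because [u] is unital. *)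
Lemma conv_Z1_invertible (u : R1) :
  u 1 = 1 -> (forall b, α b * u = u * α b) -> M u = conv_map α u * ι u ->
  exists v, u * v = 1 /\ v * u = 1.
Proof.
move=> u1 uc Mu.
have uM h g : u (h * g) = \ten_(h1, h2 <- Δ h) (h1 ▷ u g) * u h2.
  by rewrite -conv_pullmulE Mu conv_cst_mulr.
have ucE h b : \ten_(h1, h2 <- Δ h) (h1 ▷ b) * u h2
    = \ten_(h1, h2 <- Δ h) u h1 * (h2 ▷ b).
  by have /(congr1 (fun f : R1 => f h)) := uc b.
have wl : linear (fun h => \ten_(h1, h2 <- Δ h) h1 ▷ u (S h2)).
  by linearity.
exists (Conv wl); split; apply: convE => h; rewrite convME /=.
  under eq_tsum do rewrite tsum_mull.
  rewrite -(sweedlerA (T := fun x y z => u x * (y ▷ u (S z)))); try by linearity.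
  under eq_tsum => h' h3 do rewrite -ucE -uM.
  by rewrite (sum_antipoder (F := u)) ?u1 //; linearity.
under eq_tsum do rewrite tsum_mulr.
rewrite (sweedlerA (T := fun x y z => (x ▷ u (S y)) * u z)); try by linearity.
transitivity (\ten_(h1, h' <- Δ h) h1 ▷ (\ten_(h2, h3 <- Δ h') u (S h2 * h3))).
  symmetry; under eq_tsum => h1 h'.
    rewrite (linear_of_tsum (f := fun b => h1 ▷ b)); last by linearity.
    under eq_tsum => h2 h3.
      rewrite uM ucE.
      rewrite (sum_comul_antipode (T := fun x y => u x * (y ▷ u h3)));
        try by linearity.
      rewrite (linear_of_tsum (f := fun b => h1 ▷ b)); last by linearity.
      under eq_tsum do (rewrite hactM; under eq_tsum do rewrite -hactA).
      over.
    rewrite (sweedlerA (T := fun a b h3 => \ten_(p, q <- Δ h1)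
      (p ▷ u (S b)) * ((q * S a) ▷ u h3))); try by linearity.
    under eq_tsum do rewrite tsum_exchange.
    rewrite tsum_exchange.
    over.
  rewrite (sweedlerA (T := fun p q h' => \ten_(a, s <- Δ h') \ten_(b, h3 <- Δ s)
      (p ▷ u (S b)) * ((q * S a) ▷ u h3))); try by linearity.
  apply: eq_tsum => p r.
  rewrite -(sweedlerA (T := fun q a s => \ten_(b, h3 <- Δ s)
      (p ▷ u (S b)) * ((q * S a) ▷ u h3))); try by linearity.
  under eq_tsum => t s.
    rewrite (sum_antipoder (F := fun z => \ten_(b, h3 <- Δ s)
      (p ▷ u (S b)) * (z ▷ u h3))); last by linearity.
    under eq_tsum do rewrite hact1.
    over.
  by rewrite (sum_counitl (F := fun s => \ten_(b, h3 <- Δ s)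
      (p ▷ u (S b)) * u h3)); linearity.
under eq_tsum => h1 h'.
  rewrite (sum_antipodel (F := u)); last by linearity.
  rewrite u1 linear_mapZ ?hact_one; last by linearity.
  over.
by rewrite (sum_counitr (F := fun h => ε h *: (1 : B))) //; linearity.
Qed.

End HopfCochains.

(** * Monoids represented by a ring *)

Section Representation.

(** The monoid of the elements of [A] is a copy of the multiplicative monoid of
    the ring [R]; inverses, and subgroups, can then be computed in [R]. *)
Definition represents (R : pzRingType) (T : Type) (Φ : R -> T)
    (A : set T) (op : T -> T -> T) (e : T) :=
  [/\ injective Φ, A = range Φ, forall x y, op (Φ x) (Φ y) = Φ (x * y) & e = Φ 1].

Lemma represents_inverse (R : pzRingType) (T : Type) (Φ : R -> T) A op e u t :
  represents Φ A op e ->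
  inverse_in A op e (Φ u) t <-> exists v, [/\ t = Φ v, u * v = 1 & v * u = 1].
Proof.
case=> Φi -> opE ->; split=> [[[v _ <-]]|[v [-> uv vu]]].
  by rewrite !opE => /Φi uv /Φi vu; exists v.
by split; [exists v | rewrite opE uv | rewrite opE vu].
Qed.

Lemma represents_invertible (R : pzRingType) (T : Type) (Φ : R -> T) A op e u :
  represents Φ A op e ->
  invertible_in A op e (Φ u) <-> exists v, u * v = 1 /\ v * u = 1.
Proof.
move=> rep; split=> [[t tinv]|[v [uv vu]]].
  by have [v [_ uv vu]] := (represents_inverse u t rep).1 tinv; exists v.
by exists (Φ v); apply/(represents_inverse u _ rep); exists v.
Qed.

Lemma represents_inv (R : pzRingType) (T : choiceType) (Φ : R -> T) A op e u v :
  represents Φ A op e -> u * v = 1 -> v * u = 1 -> inv_in A op e (Φ u) = Φ v.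
Proof.
move=> rep uv vu; rewrite /inv_in; apply: xget_unique => /=.
  by apply: (represents_inverse u (Φ v) rep).2; exists v.
move=> t tinv; have [v' [-> _ v'u]] := (represents_inverse u t rep).1 tinv.
congr Φ.
by rewrite -[v']mulr1 -uv mulrA v'u mul1r.
Qed.

Lemma image_bijection (R T T' : Type) (Φ : R -> T) (Φ' : R -> T') (r0 : R)
    (G : set R) :
  injective Φ -> injective Φ' ->
  exists phi, set_bij (Φ @` G) (Φ' @` G) phi /\ forall x, phi (Φ x) = Φ' x.
Proof.
move=> Φi Φ'i; pose preim t := [set x | Φ x = t].
pose g t := if pselect (exists x, preim t x) is left e then projT1 (cid e) else r0.
have gK x : g (Φ x) = x.
  rewrite /g; case: pselect => [e|[]]; last by exists x.
  by apply/Φi; exact: (projT2 (cid e)).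
exists (fun t => Φ' (g t)); split=> [|x]; last by rewrite gK.
split.
- by move=> _ [x Gx <-]; exists x; rewrite ?gK.
- by move=> _ _ /set_mem [x _ <-] /set_mem [y _ <-]; rewrite !gK => /Φ'i ->.
- by move=> _ [x Gx <-]; exists (Φ x); [exists x | rewrite gK].
Qed.

Lemma bijective_sets_image (R T T' : Type) (Φ : R -> T) (Φ' : R -> T') (r0 : R)
    (G : set R) :
  injective Φ -> injective Φ' -> bijective_sets (Φ @` G) (Φ' @` G).
Proof.
by move=> Φi Φ'i; have [phi [? _]] := image_bijection r0 G Φi Φ'i; exists phi.
Qed.

Lemma image_set_inj (R T : Type) (Φ : R -> T) :
  injective Φ -> injective (fun O : set R => Φ @` O).
Proof.
move=> Φi O O' E; apply/seteqP; split=> x Ox.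
  by have : (Φ @` O') (Φ x) by [rewrite -E; exists x]; case=> y O'y /Φi <-.
by have : (Φ @` O) (Φ x) by [rewrite E; exists x]; case=> y O'y /Φi <-.
Qed.

Section Groups.
Variables (R : pzRingType) (G : set R).
Hypothesis G1 : G 1.
Hypothesis GM : forall u v, G u -> G v -> G (u * v).
Hypothesis GV : forall u, G u -> exists v, [/\ G v, u * v = 1 & v * u = 1].

Lemma represents_group (T : Type) (Φ : R -> T) A op e :
  represents Φ A op e -> is_group (Φ @` G) op e.
Proof.
case=> _ _ opE ->; split.
- by exists 1.
- by move=> _ _ [u Gu <-] [v Gv <-]; exists (u * v); [apply: GM | rewrite opE].
- by move=> _ _ _ [u _ <-] [v _ <-] [w _ <-]; rewrite !opE mulrA.
- by move=> _ [u _ <-]; rewrite !opE mul1r mulr1.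
- move=> _ [u /GV [v [Gv uv vu]] <-].
  by exists (Φ v); split; [exists v | rewrite opE uv | rewrite opE vu].
Qed.

Lemma group_isomorphic_image (T T' : Type) (Φ : R -> T) (Φ' : R -> T')
    A op e A' op' e' :
  represents Φ A op e -> represents Φ' A' op' e' ->
  group_isomorphic (Φ @` G) op e (Φ' @` G) op' e'.
Proof.
move=> rep rep'; split; [exact: represents_group rep
  | exact: represents_group rep' | ].
case: rep rep' => Φi _ opE _ [Φ'i _ opE' _].
have [phi [phi_bij phiE]] := image_bijection 1 G Φi Φ'i.
by exists phi; split=> // _ _ [u _ <-] [v _ <-]; rewrite opE !phiE opE'.
Qed.

End Groups.
End Representation.

(** * The Hopf algebra side *)

Section HopfSide.
Variables (k : fieldType) (H : hopfAlgType k) (B : modAlgType H).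
Local Notation Δ := (@comul k H).
Local Notation ε := (@counit k H).
Local Notation R1 := (conv H B).
Local Notation R2 := (conv H R1).
Local Notation α := (@conv_act k H B).
Local Notation ι := (@conv_cst k H _).
Local Notation M := (@conv_pullmul k H _).

Lemma hopf_represents1 :
  represents (@conv_fun k H B) (@hopf_hom1 k H B) (hopf_conv1 H B) (hopf_unit1 H B).
Proof.
split=> // [u v uv|]; first by apply: convE => h; rewrite uv.
apply/seteqP; split=> [f fl|_ [u _ <-]]; last exact: convP.
by exists (Conv fl).
Qed.

Definition hopf_cochain2 (γ : R2) : tens H H -> B := fun w => \ten_(h, g <- w) γ g h.

Lemma linear_hopf_cochain2 γ : linear (hopf_cochain2 γ).
Proof. by rewrite /hopf_cochain2; linearity. Qed.

Lemma hopf_cochain2E γ h g : hopf_cochain2 γ (h ⊗ g) = γ g h.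
Proof. by rewrite /hopf_cochain2 tsum_tpure //; linearity. Qed.

Fact curry_linear1 (f : tens H H -> B) (fl : linear f) g :
  linear (fun h => f (h ⊗ g)).
Proof. by linearity. Qed.

Fact curry_linear2 (f : tens H H -> B) (fl : linear f) :
  linear (fun g => Conv (curry_linear1 fl g)).
Proof. by move=> c x y; apply: convE => h /=; rewrite linear_tpurer fl. Qed.

Lemma hopf_cochain2_surj f : linear f -> exists γ, hopf_cochain2 γ = f.
Proof.
move=> fl; exists (Conv (curry_linear2 fl)); apply/funext; apply: btens_ext => //.
  exact: linear_hopf_cochain2.
by move=> h g; rewrite -[pure h g]/(h ⊗ g) hopf_cochain2E.
Qed.

(** In [R2] the outer variable is [g], while the sums of the cochain complex of
    [H] run over [h] first. *)
Lemma conv2ME (γ δ : R2) g h : (γ * δ) g h =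
  \ten_(h1, h2 <- Δ h) \ten_(g1, g2 <- Δ g) γ g1 h1 * δ g2 h2.
Proof.
rewrite convME (linear_of_tsum (f := fun f : R1 => f h)) // [RHS]tsum_exchange.
by [].
Qed.

Lemma hopf_represents2 : represents hopf_cochain2
  (@hopf_hom2 k H B) (@hopf_conv2 k H B) (@hopf_unit2 k H B).
Proof.
split=> [γ δ E||γ δ|].
- apply: convE => g; apply: convE => h.
  by rewrite -!hopf_cochain2E E.
- apply/seteqP; split=> [f fl|_ [γ _ <-]].
    by have [γ <-] := hopf_cochain2_surj fl; exists γ.
  exact: linear_hopf_cochain2.
- apply/funext => w; apply: eq_tsum => h g; rewrite conv2ME.
  by do 2 apply: eq_tsum => ? ?; rewrite !hopf_cochain2E.
- apply/funext => w; apply: eq_tsum => h g.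
  by rewrite /= scalerA mulrC.
Qed.

Lemma hopf_C1E : hopf_C1 H B = @conv_fun k H B @` @conv_C1 k H B.
Proof.
apply/seteqP; split=> [f [/= ul u1 ui uc]|_ [u [u1 ui uc] <-]].
  exists (Conv ul) => //; split=> // [|b].
    exact/(represents_invertible (Conv ul) hopf_represents1).
  by apply: convE => h; apply: uc.
split=> //; first exact: convP.
  exact/(represents_invertible u hopf_represents1).
by move=> h b; have /(congr1 (fun f : R1 => f h)) := uc b.
Qed.

Lemma hopf_Z1E : hopf_Z1 H B = @conv_fun k H B @` @conv_Z1 k H B.
Proof.
have cocycleE (u : R1) :
    (forall h g, u (h * g) = \ten_(h1, h2 <- Δ h) (h1 ▷ u g) * u h2) <->
    M u = conv_map α u * ι u.
  split=> [uM|Mu h g]; last by rewrite -conv_pullmulE Mu conv_cst_mulr.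
  apply: convE => g; apply: convE => h.
  by rewrite conv_cst_mulr conv_pullmulE uM.
apply/seteqP; split=> [f [/= ul u1 uM uc]|_ [u [[u1 ui uc] Mu] <-]].
  have uc' b : α b * Conv ul = Conv ul * α b by apply: convE => h; apply: uc.
  have Mu : M (Conv ul) = conv_map α (Conv ul) * ι (Conv ul) by apply/cocycleE.
  by exists (Conv ul) => //; split=> //; split=> //; apply: conv_Z1_invertible.
split=> //; [exact: convP | exact/cocycleE | ].
by move=> h b; have /(congr1 (fun f : R1 => f h)) := uc b.
Qed.

Lemma hopf_Z2E : hopf_Z2 H B = hopf_cochain2 @` @conv_Z2 k H B.
Proof.
have normE (γ : R2) : (forall h, hopf_cochain2 γ (h ⊗ 1) = ε h *: 1 /\
    hopf_cochain2 γ (1 ⊗ h) = ε h *: 1) <->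
    γ 1 = 1 /\ forall h, γ h 1 = ε h *: 1.
  split=> [n|[n1 n2] h]; last by rewrite !hopf_cochain2E n1 n2.
  split=> [|h]; last by have [_] := n h; rewrite hopf_cochain2E.
  by apply: convE => h; have [+ _] := n h; rewrite hopf_cochain2E.
have cocycleE (γ : R2) : (forall h g f : H,
        \ten_(h1, h2 <- Δ h) \ten_(g1, g2 <- Δ g) \ten_(f1, f2 <- Δ f)
          (h1 ▷ hopf_cochain2 γ (g1 ⊗ f1)) * hopf_cochain2 γ (h2 ⊗ (g2 * f2)) =
        \ten_(h1, h2 <- Δ h) \ten_(g1, g2 <- Δ g)
          hopf_cochain2 γ (h1 ⊗ g1) * hopf_cochain2 γ ((h2 * g2) ⊗ f)) <->
    conv_map (conv_map α) γ * M γ = ι γ * conv_map M γ.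
  have lhsE h g f : (conv_map (conv_map α) γ * M γ) f g h =
      \ten_(h1, h2 <- Δ h) \ten_(g1, g2 <- Δ g) \ten_(f1, f2 <- Δ f)
        (h1 ▷ hopf_cochain2 γ (g1 ⊗ f1)) * hopf_cochain2 γ (h2 ⊗ (g2 * f2)).
    rewrite convME (linear_of_tsum (f := fun x : R2 => x g h)) //.
    under eq_tsum do rewrite conv2ME.
    rewrite [LHS]tsum_exchange; apply: eq_tsum => h1 h2.
    rewrite [LHS]tsum_exchange; apply: eq_tsum => g1 g2.
    by apply: eq_tsum => f1 f2; rewrite !hopf_cochain2E.
  have rhsE h g f : (ι γ * conv_map M γ) f g h =
      \ten_(h1, h2 <- Δ h) \ten_(g1, g2 <- Δ g)
        hopf_cochain2 γ (h1 ⊗ g1) * hopf_cochain2 γ ((h2 * g2) ⊗ f).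
    rewrite conv_cst_mull conv2ME.
    by do 2 apply: eq_tsum => ? ?; rewrite !hopf_cochain2E.
  split=> [E|E h g f]; last by rewrite -lhsE -rhsE E.
  apply: convE => f; apply: convE => g; apply: convE => h.
  by rewrite lhsE rhsE.
have centralE (γ : R2) : (forall (h g : H) (b : B),
        \ten_(h1, h2 <- Δ h) \ten_(g1, g2 <- Δ g)
          hopf_cochain2 γ (h1 ⊗ g1) * ((h2 * g2) ▷ b) =
        \ten_(h1, h2 <- Δ h) \ten_(g1, g2 <- Δ g)
          ((h1 * g1) ▷ b) * hopf_cochain2 γ (h2 ⊗ g2)) <->
     forall b, γ * conv_map α (α b) = conv_map α (α b) * γ.
  have lhsE h g b : (γ * conv_map α (α b)) g h = \ten_(h1, h2 <- Δ h)
      \ten_(g1, g2 <- Δ g) hopf_cochain2 γ (h1 ⊗ g1) * ((h2 * g2) ▷ b).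
    by rewrite conv2ME; do 2 apply: eq_tsum => ? ?; rewrite hopf_cochain2E hactA.
  have rhsE h g b : (conv_map α (α b) * γ) g h = \ten_(h1, h2 <- Δ h)
      \ten_(g1, g2 <- Δ g) ((h1 * g1) ▷ b) * hopf_cochain2 γ (h2 ⊗ g2).
    by rewrite conv2ME; do 2 apply: eq_tsum => ? ?; rewrite hopf_cochain2E hactA.
  split=> [E b|E h g b]; last by rewrite -lhsE -rhsE E.
  by apply: convE => g; apply: convE => h; rewrite lhsE rhsE.
apply/seteqP; split=> [f [/= fl]|_ [γ [ui /normE un /cocycleE uc /centralE ub] <-]].
  have [γ <-] := hopf_cochain2_surj fl.
  case/(represents_invertible γ hopf_represents2) => δ ui.
  move=> /normE un /cocycleE uc /centralE ub.
  by exists γ => //; split=> //; exists δ.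
split=> //; first exact: linear_hopf_cochain2.
exact/(represents_invertible γ hopf_represents2).
Qed.

(** The action of a one-cochain [u] with inverse [v]. *)
Definition gauge (u v : R1) (γ : R2) : R2 := ι v * conv_map α v * γ * M u.

Definition gauge_orbit (γ : R2) : set R2 := [set δ |
  exists u v, [/\ conv_C1 u, u * v = 1, v * u = 1 & δ = gauge u v γ]].

Lemma hopf_act2E (u v : R1) (γ : R2) : u * v = 1 -> v * u = 1 ->
  hopf_act2 (hopf_cochain2 γ) u = hopf_cochain2 (gauge u v γ).
Proof.
move=> uv vu; apply/funext => w; apply: eq_tsum => h g.
have -> : hopf_inv1 (u : H -> B) = v :> (H -> B).
  exact: represents_inv hopf_represents1 uv vu.
rewrite /gauge -!mulrA conv_cst_mull convME; apply: eq_tsum => h1 h'.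
rewrite conv2ME tsum_mull; apply: eq_tsum => h2 h''.
rewrite tsum_mull [LHS]tsum_exchange; apply: eq_tsum => g1 g'.
rewrite conv2ME !tsum_mull; apply: eq_tsum => h3 h4.
rewrite !tsum_mull; apply: eq_tsum => g2 g3.
by rewrite hopf_cochain2E !mulrA.
Qed.

(** Orbits are transported by any pair of maps that turns [gauge] into the given
    action, hence the sets of orbits on the two sides are images of the same set
    of subsets of [R2]. *)
Lemma gauge_orbits_image (T1 T2 : Type) (Φ1 : R1 -> T1) (Φ2 : R2 -> T2)
    (act : T2 -> T1 -> T2) :
  (forall u v γ, conv_C1 u -> u * v = 1 -> v * u = 1 ->
     act (Φ2 γ) (Φ1 u) = Φ2 (gauge u v γ)) ->
  [set [set act Γ U | U in Φ1 @` @conv_C1 k H B] | Γ in Φ2 @` @conv_Z2 k H B] =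
  (fun O => Φ2 @` O) @` (gauge_orbit @` @conv_Z2 k H B).
Proof.
move=> actE.
have orbitE γ : [set act (Φ2 γ) U | U in Φ1 @` @conv_C1 k H B] = Φ2 @` gauge_orbit γ.
  apply/seteqP; split=> [_ [_ [u uC <-] <-]|_ [_ [u [v [uC uv vu ->]]] <-]].
    have [_ [v [uv vu]] _] := uC; exists (gauge u v γ); first by exists u, v.
    by rewrite (actE _ _ _ uC uv vu).
  by exists (Φ1 u); [exists u | rewrite (actE _ _ _ uC uv vu)].
apply/seteqP; split=> [_ [_ [γ γZ <-] <-]|_ [_ [γ γZ <-] <-]].
  by exists (gauge_orbit γ); [exists γ | rewrite orbitE].
by exists (Φ2 γ); [exists γ | rewrite orbitE].
Qed.

Lemma hopf_H2E : hopf_H2 H B =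
  (fun O => hopf_cochain2 @` O) @` (gauge_orbit @` @conv_Z2 k H B).
Proof.
rewrite /hopf_H2 hopf_Z2E hopf_C1E; apply: gauge_orbits_image => u v γ _.
exact: hopf_act2E.
Qed.

End HopfSide.

(** * Elements of the Hopf algebroid *)

Section Generators.
Variables (k : fieldType) (H : hopfAlgType k) (B : modAlgType H).
Local Notation mk := (@BeH_mk k H B).

Lemma linear_mk1 b' h : linear (fun b => mk b b' h).
Proof. exact: linear_tpurel. Qed.
Lemma linear_mk2 b h : linear (fun b' => mk b b' h).
Proof.
exact: (linear_comp (f := fun x => b ⊗ x) (linear_tpurer b) (linear_tpurel h)).
Qed.
Lemma linear_mk3 b b' : linear (fun h => mk b b' h).
Proof.
exact: (linear_comp (f := fun x => b ⊗ x) (linear_tpurer b) (linear_tpurer b')).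
Qed.

End Generators.

#[local] Hint Extern 0 (GRing.linear_for _ _) => (apply: linear_mk1) : linear.
#[local] Hint Extern 0 (GRing.linear_for _ _) => (apply: linear_mk2) : linear.
#[local] Hint Extern 0 (GRing.linear_for _ _) => (apply: linear_mk3) : linear.

Section SmashProduct.
Variables (k : fieldType) (H : hopfAlgType k) (B : modAlgType H).
Local Notation Δ := (@comul k H).
Local Notation S := (@antipode k H).
Local Notation L := (@BeH_bialgebroid k H B).
Local Notation mk := (@BeH_mk k H B).
Local Notation "X ∙ Y" := (@bgd_mul k B L X Y) (at level 40, left associativity).

Definition ext_mk (W : nmodType) (T : B -> B -> H -> W) (X : L) : W :=
  \ten_(b, b'h <- (X : BeH B)) \ten_(b', h <- b'h) T b b' h.

Section Extension.
Variables (W : lmodType k) (T : B -> B -> H -> W).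
Hypothesis T1 : forall b' h, linear (fun b => T b b' h).
Hypothesis T2 : forall b h, linear (fun b' => T b b' h).
Hypothesis T3 : forall b b', linear (T b b').

Lemma linear_ext_mk : linear (ext_mk T).
Proof. by rewrite /ext_mk; linearity. Qed.

Lemma ext_mkE b b' h : ext_mk T (mk b b' h) = T b b' h.
Proof. by rewrite /ext_mk /BeH_mk !tsum_tpure //; linearity. Qed.

End Extension.

Lemma mk_ext (W : lmodType k) (f g : L -> W) : linear f -> linear g ->
  (forall b b' h, f (mk b b' h) = g (mk b b' h)) -> f =1 g.
Proof.
move=> fl gl fg; apply: btens_ext => // b.
apply: btens_ext => [||b' h]; last exact: fg.
- exact: (linear_comp fl (linear_tpurer b)).
- exact: (linear_comp gl (linear_tpurer b)).
Qed.

Lemma mulmk b b' h c c' g : mk b b' h ∙ mk c c' g =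
  \ten_(h1, h2 <- Δ h) \ten_(g1, g2 <- Δ g)
    mk (b * (h1 ▷ c)) (c' * (S g2 ▷ b')) (h2 * g1).
Proof.
rewrite /= /BeH_mul -[LHS]/(ext_mk (fun b b' h => ext_mk (fun c c' g => 
  \ten_(h1, h2 <- Δ h) \ten_(g1, g2 <- Δ g)
    mk (b * (h1 ▷ c)) (c' * (S g2 ▷ b')) (h2 * g1)) (mk c c' g)) (mk b b' h)).
by rewrite ext_mkE ?ext_mkE // /ext_mk; linearity.
Qed.

Lemma linear_mulL1 Y : linear (fun X => X ∙ Y).
Proof. by rewrite /= /BeH_mul; linearity. Qed.

Lemma linear_mulL2 X : linear (fun Y => X ∙ Y).
Proof. by rewrite /= /BeH_mul; linearity. Qed.

End SmashProduct.

#[local] Hint Extern 0 (GRing.linear_for _ _) => (apply: linear_mulL1) : linear.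
#[local] Hint Extern 0 (GRing.linear_for _ _) => (apply: linear_mulL2) : linear.

Section StraightenedElements.
Variables (k : fieldType) (H : hopfAlgType k) (B : modAlgType H).
Local Notation Δ := (@comul k H).
Local Notation S := (@antipode k H).
Local Notation L := (@BeH_bialgebroid k H B).
Local Notation mk := (@BeH_mk k H B).
Local Notation s := (@bgd_src k B L).
Local Notation t := (@bgd_tgt k B L).

(** The right-hand copy of [B] is acted upon through [S], which reverses both
    products and coproducts, so [S q] acts by a twisted Leibniz rule. *)
Lemma sum_antipode_hact q (e y : B) :
  \ten_(q1, q2 <- Δ q) (S q2 ▷ e) * (S q1 ▷ y) = S q ▷ (e * y).
Proof.
rewrite hactM (sum_comul_antipode (T := fun x w => (x ▷ e) * (w ▷ y))) //;
  by linearity.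
Qed.

Lemma sum_hact_antipode r (e d : B) :
  \ten_(a, z <- Δ r) a ▷ (e * (S z ▷ d)) = (r ▷ e) * d.
Proof.
under eq_tsum => a z do (rewrite hactM; under eq_tsum do rewrite -hactA).
rewrite (sweedlerA (T := fun m n z => (m ▷ e) * ((n * S z) ▷ d)));
  try by linearity.
under eq_tsum => m r'.
  rewrite (sum_antipoder (F := fun x => (m ▷ e) * (x ▷ d))) ?hact1;
    last by linearity.
  over.
by rewrite (sum_counitr (F := fun m => (m ▷ e) * d)) //; linearity.
Qed.

(** The element [s(b) t(d) (1 ⊗ 1 # h)] of [L]: the right-hand copy of [B] is moved
    to the left of [h]. *)
Definition stH (b d : B) (h : H) : L := \ten_(h1, h2 <- Δ h) mk b (S h2 ▷ d) h1.

Lemma linear_stH1 d h : linear (fun b => stH b d h).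
Proof. by rewrite /stH; linearity. Qed.
Lemma linear_stH2 b h : linear (fun d => stH b d h).
Proof. by rewrite /stH; linearity. Qed.
Lemma linear_stH3 b d : linear (fun h => stH b d h).
Proof. by rewrite /stH; linearity. Qed.

End StraightenedElements.

#[local] Hint Extern 0 (GRing.linear_for _ _) => (apply: linear_stH1) : linear.
#[local] Hint Extern 0 (GRing.linear_for _ _) => (apply: linear_stH2) : linear.
#[local] Hint Extern 0 (GRing.linear_for _ _) => (apply: linear_stH3) : linear.

Section SmashElements.
Variables (k : fieldType) (H : hopfAlgType k) (B : modAlgType H).
Local Notation Δ := (@comul k H).
Local Notation ε := (@counit k H).
Local Notation S := (@antipode k H).
Local Notation L := (@BeH_bialgebroid k H B).
Local Notation mk := (@BeH_mk k H B).
Local Notation "X ∙ Y" := (@bgd_mul k B L X Y) (at level 40, left associativity).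
Local Notation s := (@bgd_src k B L).
Local Notation t := (@bgd_tgt k B L).

Local Notation st := (@stH k H B).

(** Passing from [stH] to [BeH_mk] twists the second entry by [S h2], and
    twisting back by [h2] undoes this by the antipode axiom; so the elements
    [stH b d h] span [L]. *)
Lemma mk_stH b b' h : mk b b' h = \ten_(h1, h2 <- Δ h) st b (h2 ▷ b') h1.
Proof.
rewrite /stH (sweedlerA (T := fun h1 h2 h3 => mk b (S h2 ▷ h3 ▷ b') h1));
  try by linearity.
under eq_tsum => h1 r.
  under eq_tsum do rewrite -hactA.
  rewrite (sum_antipodel (F := fun x => mk b (x ▷ b') h1)) ?hact1;
    last by linearity.
  over.
by rewrite (sum_counitr (F := fun h1 => mk b b' h1)) //; linearity.
Qed.

Lemma stH_mkl b h : st b 1 h = mk b 1 h.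
Proof.
rewrite mk_stH; under eq_tsum => h1 h2.
  rewrite hact_one (linear_mapZ _ _ (linear_stH2 _ _)); over.
by rewrite (sum_counitr (F := fun h1 => st b 1 h1)) //; linearity.
Qed.

Lemma stH_mkr b d : st b d 1 = mk b d 1.
Proof. by rewrite mk_stH sum_comul1 ?hact1 //; linearity. Qed.

Lemma srcE b : s b = st b 1 1. Proof. by rewrite stH_mkl. Qed.
Lemma tgtE b : t b = st 1 b 1. Proof. by rewrite stH_mkr. Qed.
Lemma oneE : bgd_one L = st 1 1 1. Proof. by rewrite stH_mkl. Qed.

Definition ext_stH (W : nmodType) (T : B -> B -> H -> W) : L -> W :=
  ext_mk (fun b b' h => \ten_(h1, h2 <- Δ h) T b (h2 ▷ b') h1).

Section StExtension.
Variables (W : lmodType k) (T : B -> B -> H -> W).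
Hypothesis T1 : forall d h, linear (fun b => T b d h).
Hypothesis T2 : forall b h, linear (fun d => T b d h).
Hypothesis T3 : forall b d, linear (T b d).

Lemma linear_ext_stH : linear (ext_stH T).
Proof. by apply: linear_ext_mk; linearity. Qed.

(** The elements [stH b d h] are free in the sense that trilinear functions of
    [(b, d, h)] extend to [L]. *)
Lemma ext_stHE b d h : ext_stH T (st b d h) = T b d h.
Proof.
have mkE b' x : ext_stH T (mk b b' x) = \ten_(h1, h2 <- Δ x) T b (h2 ▷ b') h1.
  by rewrite /ext_stH ext_mkE //; linearity.
rewrite /stH (linear_of_tsum _ _ linear_ext_stH).
under eq_tsum do rewrite mkE.
rewrite (sweedlerA (T := fun h1 h2 h3 => T b (h2 ▷ S h3 ▷ d) h1)); try by linearity.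
under eq_tsum => h1 r.
  under eq_tsum do rewrite -hactA.
  rewrite (sum_antipoder (F := fun x => T b (x ▷ d) h1)) ?hact1; last by linearity.
  over.
by rewrite (sum_counitr (F := fun h1 => T b d h1)).
Qed.

End StExtension.

Lemma stH_ext (W : lmodType k) (f g : L -> W) : linear f -> linear g ->
  (forall b d h, f (st b d h) = g (st b d h)) -> f =1 g.
Proof.
move=> fl gl fg; apply: mk_ext => // b b' h.
by rewrite mk_stH !linear_of_tsum //; apply: eq_tsum.
Qed.

(** Sliding [h] to the right past [s(c) t(e)] lets [h1] act on [c] and [h3] on [e],
    as the source and target are acted upon from the two outer sides. The
    product is computed on the spanning set [BeH_mk] and converted by [mk_stH];
    all occurrences of the antipode cancel on the way. *)
Lemma stHM b d h c e g : st b d h ∙ st c e g =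
  \ten_(h1, r <- Δ h) \ten_(h2, h3 <- Δ r)
    stH (b * (h1 ▷ c)) ((h3 ▷ e) * d) (h2 * g).
Proof.
rewrite {1 2}/stH (linear_of_tsum _ _ (linear_mulL1 _)).
under eq_tsum => h' z.
  rewrite (linear_of_tsum _ _ (linear_mulL2 _)).
  under eq_tsum do rewrite mulmk.
  rewrite tsum_exchange.
  over.
rewrite (sweedlerA (T := fun h1 h2 z => \ten_(g', w <- Δ g) \ten_(g1, g2 <- Δ g')
  mk (b * (h1 ▷ c)) ((S w ▷ e) * (S g2 ▷ S z ▷ d)) (h2 * g1))); try by linearity.
apply: eq_tsum => h1 r; set p := b * _.
transitivity (\ten_(h2, z <- Δ r) \ten_(g1, q <- Δ g)
    mk p (S q ▷ (e * (S z ▷ d))) (h2 * g1)).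
  apply: eq_tsum => h2 z.
  rewrite (sweedlerA (T := fun g1 g2 w =>
    mk p ((S w ▷ e) * (S g2 ▷ S z ▷ d)) (h2 * g1))); try by linearity.
  apply: eq_tsum => g1 q.
  rewrite -sum_antipode_hact (linear_of_tsum (f := fun x => mk p x (h2 * g1))) //.
  by linearity.
transitivity (\ten_(h2, z <- Δ r) \ten_(a1, a2 <- Δ h2)
    st p (a2 ▷ (e * (S z ▷ d))) (a1 * g)).
  apply: eq_tsum => h2 z.
  under eq_tsum => g1 q.
    rewrite mk_stH.
    rewrite (sum_comulM (F := fun x y => st p (y ▷ S q ▷ (e * (S z ▷ d))) x));
      try by linearity.
    over.
  rewrite tsum_exchange; apply: eq_tsum => a1 a2.
  rewrite (sweedlerA (T := fun f1 f2 q =>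
    st p ((a2 * f2) ▷ S q ▷ (e * (S z ▷ d))) (a1 * f1))); try by linearity.
  under eq_tsum => f1 q'.
    under eq_tsum do rewrite -hactA -mulrA.
    rewrite (sum_antipoder (F := fun x =>
      st p ((a2 * x) ▷ (e * (S z ▷ d))) (a1 * f1))) ?mulr1; last by linearity.
    over.
  rewrite (sum_counitr (F := fun f1 => st p (a2 ▷ (e * (S z ▷ d))) (a1 * f1))) //.
  by linearity.
rewrite (sweedlerA (T := fun a1 a2 z => st p (a2 ▷ (e * (S z ▷ d))) (a1 * g)));
  try by linearity.
apply: eq_tsum => a1 r'.
rewrite -sum_hact_antipode (linear_of_tsum (f := fun x => st p x (a1 * g))) //.
by linearity.
Qed.

Lemma linear_comulL : linear (@bgd_comul k B L).
Proof. by rewrite /= /BeH_comul; linearity. Qed.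

Lemma linear_counitL : linear (@bgd_counit k B L).
Proof. by rewrite /= /BeH_counit; linearity. Qed.

(** [s(b)] goes to the first factor and [t(d)] to the second, as for the
    elements [BeH_mk]. *)
Lemma comul_stH b d h : bgd_comul (st b d h) =
  \ten_(h1, h2 <- Δ h) pure (st b 1 h1) (st 1 d h2).
Proof.
have comul_mk b' x : @bgd_comul k B L (mk b b' x) =
    \ten_(h1, h2 <- Δ x) pure (mk b 1 h1) (mk 1 b' h2).
  by rewrite /= /BeH_comul -[LHS]/(ext_mk (fun b b' x => 
    \ten_(h1, h2 <- Δ x) pure (mk b 1 h1) (mk 1 b' h2)) (mk b b' x)) ext_mkE //;
    linearity.
rewrite {1}/stH (linear_of_tsum _ _ linear_comulL).
under eq_tsum do rewrite comul_mk.
rewrite (sweedlerA (T := fun h1 h2 h3 => pure (mk b 1 h1) (mk 1 (S h3 ▷ d) h2)));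
  try by linearity.
apply: eq_tsum => h1 r; rewrite stH_mkl /stH.
by rewrite (linear_of_tsum (f := fun x => pure (mk b 1 h1) x)) //; linearity.
Qed.

Lemma counit_stH b d h : bgd_counit L (st b d h) = ε h *: (b * d).
Proof.
have counit_mk b' x : bgd_counit L (mk b b' x) = b * (x ▷ b').
  by rewrite /= /BeH_counit -[LHS]/(ext_mk (fun b b' x => b * (x ▷ b'))
    (mk b b' x)) ext_mkE //; linearity.
rewrite /stH (linear_of_tsum _ _ linear_counitL).
under eq_tsum do rewrite counit_mk -hactA.
by rewrite (sum_antipoder (F := fun x => b * (x ▷ d))) ?hact1 //; linearity.
Qed.

End SmashElements.

Section SourceTarget.
Variables (k : fieldType) (H : hopfAlgType k) (B : modAlgType H).
Local Notation Δ := (@comul k H).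
Local Notation L := (@BeH_bialgebroid k H B).
Local Notation "X ∙ Y" := (@bgd_mul k B L X Y) (at level 40, left associativity).
Local Notation s := (@bgd_src k B L).
Local Notation t := (@bgd_tgt k B L).
Local Notation ΔL := (@bgd_comul k B L).
Local Notation st := (@stH k H B).

Lemma linear_src : linear s.
Proof. by move=> c a b; rewrite !srcE linear_stH1. Qed.

Lemma linear_tgt : linear t.
Proof. by move=> c a b; rewrite !tgtE linear_stH2. Qed.

Lemma src_tgt a b : s a ∙ t b = st a b 1.
Proof.
rewrite srcE tgtE stHM sum_comul1; try by linearity.
by rewrite sum_comul1; [rewrite !hact1 !mulr1 | linearity ..].
Qed.

Lemma st1M a b c e g : st a b 1 ∙ st c e g = st (a * c) (e * b) g.
Proof.
rewrite stHM sum_comul1; try by linearity.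
by rewrite sum_comul1; [rewrite !hact1 mul1r | linearity ..].
Qed.

Lemma srcM a c e g : s a ∙ st c e g = st (a * c) e g.
Proof. by rewrite srcE st1M mulr1. Qed.

Lemma tgtM a c e g : t a ∙ st c e g = st c (e * a) g.
Proof. by rewrite tgtE st1M mul1r. Qed.

Lemma src_srcM a b X : s (a * b) ∙ X = s a ∙ (s b ∙ X).
Proof.
by move: X; apply: stH_ext => [||c e g]; [linearity .. | rewrite !srcM mulrA].
Qed.

Lemma balanced_comul (W : lmodType k) (F : L -> L -> W) b d h :
  balanced (fun a X => t a ∙ X) (fun a X => s a ∙ X) F ->
  tsum (ΔL (st b d h)) F = \ten_(h1, h2 <- Δ h) F (st b 1 h1) (st 1 d h2).
Proof.
move=> Fb; rewrite comul_stH (linear_of_tsum _ _ (linear_tsum_bal Fb)).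
by apply: eq_tsum => h1 h2; rewrite tsum_pureE.
Qed.

Lemma linear_sum_comul (W : lmodType k) (F : L -> L -> W) :
  balanced (fun a X => t a ∙ X) (fun a X => s a ∙ X) F ->
  linear (fun X => tsum (ΔL X) F).
Proof.
move=> Fb; exact: (linear_comp (linear_tsum_bal Fb) (@linear_comulL _ _ B)).
Qed.

End SourceTarget.

#[local] Hint Extern 0 (GRing.linear_for _ _) => (apply: linear_src) : linear.
#[local] Hint Extern 0 (GRing.linear_for _ _) => (apply: linear_tgt) : linear.

(** * One-cochains of the Hopf algebroid *)

Section OneCochains.
Variables (k : fieldType) (H : hopfAlgType k) (B : modAlgType H).
Local Notation R1 := (conv H B).
Local Notation R2 := (conv H R1).
Local Notation L := (@BeH_bialgebroid k H B).

Implicit Types (γ δ : R2) (u v : R1) (X Y Z : L).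

Definition bgd_cochain1 (u : R1) : L -> B := ext_stH (fun b d h => b * u h * d).

Lemma linear_cochain1 u : linear (bgd_cochain1 u).
Proof. by apply: linear_ext_stH; linearity. Qed.

End OneCochains.

#[local] Hint Extern 0 (GRing.linear_for _ _) => (apply: linear_cochain1) : linear.

Section OneCochainsGroup.
Variables (k : fieldType) (H : hopfAlgType k) (B : modAlgType H).
Local Notation Δ := (@comul k H).
Local Notation R1 := (conv H B).
Local Notation R2 := (conv H R1).
Local Notation α := (@conv_act k H B).
Local Notation M := (@conv_pullmul k H _).
Local Notation L := (@BeH_bialgebroid k H B).
Local Notation "X ∙ Y" := (@bgd_mul k B L X Y) (at level 40, left associativity).
Local Notation s := (@bgd_src k B L).
Local Notation t := (@bgd_tgt k B L).
Local Notation st := (@stH k H B).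

Implicit Types (γ δ : R2) (u v : R1) (X Y Z : L).

(** The shape in which [stHM] produces a product of three factors of [R1]. *)
Lemma conv_sandwich (x : R1) b a a' d h : b * (α a * x * α a') h * d =
  \ten_(h1, r <- Δ h) \ten_(h2, h3 <- Δ r) (b * (h1 ▷ a)) * x h2 * ((h3 ▷ a') * d).
Proof.
rewrite -(mulrA (α a)) convME tsum_mull tsum_mulr; apply: eq_tsum => h1 r.
rewrite convME !tsum_mull tsum_mulr.
by apply: eq_tsum => h2 h3; rewrite !mulrA.
Qed.

Lemma cochain1E u b d h : bgd_cochain1 u (st b d h) = b * u h * d.
Proof. by rewrite /bgd_cochain1 ext_stHE //; linearity. Qed.

Lemma cochain1_src u a X : bgd_cochain1 u (s a ∙ X) = a * bgd_cochain1 u X.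
Proof.
by move: X; apply: stH_ext => [||c e g];
  [linearity .. | rewrite srcM !cochain1E !mulrA].
Qed.

Lemma cochain1_tgt u a X : bgd_cochain1 u (t a ∙ X) = bgd_cochain1 u X * a.
Proof.
by move: X; apply: stH_ext => [||c e g];
  [linearity .. | rewrite tgtM !cochain1E !mulrA].
Qed.

Lemma cochain1M u b d h c e g : bgd_cochain1 u (st b d h ∙ st c e g) =
  b * (α c * M u g * α e) h * d.
Proof.
have fl := linear_cochain1 u.
rewrite stHM conv_sandwich (linear_of_tsum _ _ fl); apply: eq_tsum => h1 r.
by rewrite (linear_of_tsum _ _ fl); apply: eq_tsum => h2 h3; rewrite cochain1E.
Qed.

Lemma conv_pullmul1 (A : algType k) (f : conv H A) : conv_pullmul f 1 = f.
Proof. by apply: convE => h; rewrite conv_pullmulE mulr1. Qed.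

(** As [stH b d h = s(b) t(d) (1 ⊗ 1 # h)], a bimodule map is determined by
    [u h = f (1 ⊗ 1 # h)]. *)
Lemma cochain1_surj f : bgd_hom1 f -> exists u, bgd_cochain1 u = f.
Proof.
move=> [fl fE].
have ul : linear (fun h => f (st 1 1 h)) by linearity.
exists (Conv ul); apply/funext; apply: stH_ext => // [|b d h].
  exact: linear_cochain1.
by rewrite cochain1E -fE tgtM srcM mul1r mulr1.
Qed.

Lemma balanced_cochain1 u v :
  balanced (fun a X => t a ∙ X) (fun a X => s a ∙ X)
    (fun X Y => bgd_cochain1 u X * bgd_cochain1 v Y).
Proof.
split=> [Y|X|a X Y]; try by linearity.
by rewrite cochain1_tgt cochain1_src mulrA.
Qed.

Lemma bgd_represents1 :
  represents (@bgd_cochain1 k H B) (@bgd_hom1 k B L) (bgd_conv1 L) (bgd_counit L).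
Proof.
split=> [u v E||u v|].
- apply: convE => h; have := congr1 (fun f => f (st 1 1 h)) E.
  by rewrite !cochain1E !mul1r !mulr1.
- apply/seteqP; split=> [f fh|_ [u _ <-]].
    by have [u <-] := cochain1_surj fh; exists u.
  split; first exact: linear_cochain1.
  by move=> b c X; rewrite cochain1_src cochain1_tgt mulrA.
- apply/funext; have bal := balanced_cochain1 u v.
  apply: stH_ext => [||b d h]; [exact: linear_sum_comul | exact: linear_cochain1 | ].
  rewrite /bgd_conv1 balanced_comul // cochain1E convME tsum_mull tsum_mulr.
  by apply: eq_tsum => h1 h2; rewrite !cochain1E mulr1 mul1r !mulrA.
- apply/funext; apply: stH_ext => [||b d h].
  + exact: linear_counitL.
  + exact: linear_cochain1.
  + by rewrite counit_stH cochain1E conv1E -scalerAr mulr1 scalerAl.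
Qed.

(** By [cochain1M], right multiplication by [s(e)] and [t(e)] turns [u] into
    [α e * u] and [u * α e], so equality of the two is centrality. *)
Lemma bgd_C1E : bgd_C1 L = @bgd_cochain1 k H B @` @conv_C1 k H B.
Proof.
have unitE (u : R1) : bgd_cochain1 u (bgd_one L) = u 1.
  by rewrite oneE cochain1E mul1r mulr1.
have centralE (u : R1) :
    (forall X b, bgd_cochain1 u (X ∙ s b) = bgd_cochain1 u (X ∙ t b)) <->
    forall b, α b * u = u * α b.
  have srcE' b d h e : bgd_cochain1 u (st b d h ∙ s e) = b * (α e * u) h * d.
    by rewrite srcE cochain1M conv_pullmul1 rmorph1 mulr1.
  have tgtE' b d h e : bgd_cochain1 u (st b d h ∙ t e) = b * (u * α e) h * d.
    by rewrite tgtE cochain1M conv_pullmul1 rmorph1 mul1r.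
  split=> [E b|E X e].
    apply: convE => h; have := E (st 1 1 h) b.
    by rewrite srcE' tgtE' !mul1r !mulr1.
  move: X; apply: stH_ext => [||b d h]; [linearity .. | ].
  by rewrite srcE' tgtE' E.
apply/seteqP; split=> [f [/cochain1_surj fE]|_ [u [u1 ui uc] <-]].
  have [u <-] := fE; rewrite unitE.
  by move=> /(represents_invertible u bgd_represents1) ui u1 /centralE uc; exists u.
have [_ homE _ _] := bgd_represents1.
split; [by rewrite homE; exists u | | by rewrite unitE | exact/centralE].
exact/(represents_invertible u bgd_represents1).
Qed.

End OneCochainsGroup.

(** * Two-cochains of the Hopf algebroid *)

Section Forms.
Variables (k : fieldType) (H : hopfAlgType k) (B : modAlgType H).
Local Notation R1 := (conv H B).
Local Notation R2 := (conv H R1).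
Local Notation α := (@conv_act k H B).
Local Notation L := (@BeH_bialgebroid k H B).

Implicit Types (γ δ : R2) (u v : R1) (X Y Z : L).

(** The value of the two-cochain of [γ] on the class of [(X, Y)]. The factors [c]
    and [e] of [Y = stH c e g] can be moved to [X] in the balanced tensor
    product, where [h] acts on them; this is the origin of [α c] and [α e]. *)
Definition bgd_form (γ : R2) (X Y : L) : B :=
  ext_stH (fun b d h => ext_stH (fun c e g => b * (α c * γ g * α e) h * d) Y) X.

Lemma linear_form1 γ Y : linear (fun X => bgd_form γ X Y).
Proof. by apply: linear_ext_stH; rewrite /ext_stH /ext_mk; linearity. Qed.

Lemma linear_form2 γ X : linear (fun Y => bgd_form γ X Y).
Proof. by rewrite /bgd_form /ext_stH /ext_mk; linearity. Qed.

End Forms.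

#[local] Hint Extern 0 (GRing.linear_for _ _) => (apply: linear_form1) : linear.
#[local] Hint Extern 0 (GRing.linear_for _ _) => (apply: linear_form2) : linear.

Section TwoCochains.
Variables (k : fieldType) (H : hopfAlgType k) (B : modAlgType H).
Local Notation Δ := (@comul k H).
Local Notation R1 := (conv H B).
Local Notation R2 := (conv H R1).
Local Notation α := (@conv_act k H B).
Local Notation ι := (@conv_cst k H _).
Local Notation M := (@conv_pullmul k H _).
Local Notation L := (@BeH_bialgebroid k H B).
Local Notation "X ∙ Y" := (@bgd_mul k B L X Y) (at level 40, left associativity).
Local Notation s := (@bgd_src k B L).
Local Notation t := (@bgd_tgt k B L).
Local Notation ΔL := (@bgd_comul k B L).
Local Notation "X ⊠ Y" := (@bepure k B L X Y) (at level 45).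
Local Notation st := (@stH k H B).

Implicit Types (γ δ : R2) (u v : R1) (X Y Z : L).

Lemma formE γ b d h c e g :
  bgd_form γ (st b d h) (st c e g) = b * (α c * γ g * α e) h * d.
Proof.
by rewrite /bgd_form !ext_stHE //; rewrite /ext_stH /ext_mk; linearity.
Qed.

Lemma stH_ext2 (W : lmodType k) (f g : L -> L -> W) :
  (forall Y, linear (f ^~ Y)) -> (forall X, linear (f X)) ->
  (forall Y, linear (g ^~ Y)) -> (forall X, linear (g X)) ->
  (forall b d h c e x, f (st b d h) (st c e x) = g (st b d h) (st c e x)) ->
  forall X Y, f X Y = g X Y.
Proof.
move=> f1 f2 g1 g2 fg X Y; move: X; apply: stH_ext => // b d h.
by move: Y; apply: stH_ext => // c e x.
Qed.

Lemma form_inj γ δ : (forall X Y, bgd_form γ X Y = bgd_form δ X Y) -> γ = δ.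
Proof.
move=> E; apply: convE => g; apply: convE => h; have := E (st 1 1 h) (st 1 1 g).
by rewrite !formE !rmorph1 !mul1r !mulr1.
Qed.

Lemma form_src γ a X Y : bgd_form γ (s a ∙ X) Y = a * bgd_form γ X Y.
Proof.
move: X Y; apply: stH_ext2 => [||||b d h c e g]; try by linearity.
by rewrite srcM !formE !mulrA.
Qed.

Lemma form_tgt γ a X Y : bgd_form γ (t a ∙ X) Y = bgd_form γ X Y * a.
Proof.
move: X Y; apply: stH_ext2 => [||||b d h c e g]; try by linearity.
by rewrite tgtM !formE !mulrA.
Qed.

Lemma form_balanced γ : balanced (fun (ab : B * B) X => X ∙ (s ab.1 ∙ t ab.2))
  (fun ab Y => (s ab.1 ∙ t ab.2) ∙ Y) (@bgd_form k H B γ).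
Proof.
split=> [Y|X|[a a'] X Y]; try by linearity.
rewrite [(a, a').1]/= [(a, a').2]/= src_tgt.
move: X Y; apply: stH_ext2 => [||||b d h c e g]; try by linearity.
rewrite stHM st1M formE (linear_of_tsum (f := fun X => bgd_form γ X _));
  last by linearity.
have -> : α (a * c) * γ g * α (e * a') = α a * (α c * γ g * α e) * α a'.
  by rewrite !rmorphM /= !mulrA.
rewrite conv_sandwich; apply: eq_tsum => h1 r.
rewrite (linear_of_tsum (f := fun X => bgd_form γ X _)); last by linearity.
by apply: eq_tsum => h2 h3; rewrite formE mulr1.
Qed.

Definition bgd_cochain2 (γ : R2) : bgd_tensBe L -> B :=
  fun w => tsum w (bgd_form γ).

Lemma linear_cochain2 γ : linear (bgd_cochain2 γ).
Proof. exact/linear_tsum_bal/form_balanced. Qed.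

Lemma cochain2E γ X Y : bgd_cochain2 γ (X ⊠ Y) = bgd_form γ X Y.
Proof. exact/tsum_pureE/form_balanced. Qed.

(** Moving [s(c) t(e)] across the balanced tensor product reduces the second
    entry to [1 ⊗ 1 # g], and the bimodule property reduces the first. *)
Lemma cochain2_surj f : bgd_hom2 f -> exists γ, bgd_cochain2 γ = f.
Proof.
move=> [fl fE].
have l1 Y : linear (fun X => f (X ⊠ Y)).
  by apply: (linear_comp fl); apply: linear_purel.
have l2 X : linear (fun Y => f (X ⊠ Y)).
  by apply: (linear_comp fl); apply: linear_purer.
have ul g : linear (fun h => f (st 1 1 h ⊠ st 1 1 g)).
  exact: (linear_comp (l1 _) (linear_stH3 _ _)).
have γl : linear (fun g => Conv (ul g)).
  by move=> c x y; apply: convE => h; rewrite /= linear_stH3 l2.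
exists (Conv γl); apply/funext; apply: btens_ext => //.
  exact: linear_cochain2.
move=> X Y; rewrite -[pure X Y]/(X ⊠ Y) cochain2E.
move: X Y; apply: stH_ext2 => [||||b d h c e g] //; try by linearity.
have -> : st b d h ⊠ st c e g = (st b d h ∙ (s c ∙ t e)) ⊠ st 1 1 g.
  rewrite -{1}[c]mulr1 -{1}[e]mul1r -st1M -src_tgt.
  by have [_ _ bal] := balanced_pure (fun ab X => X ∙ (s ab.1 ∙ t ab.2))
    (fun ab Y => (s ab.1 ∙ t ab.2) ∙ Y); rewrite /bepure (bal (c, e)).
rewrite src_tgt stHM formE conv_sandwich (linear_of_tsum _ _ (l1 _)).
apply: eq_tsum => h1 r; rewrite (linear_of_tsum _ _ (l1 _)).
apply: eq_tsum => h2 h3; rewrite mulr1 -fE tgtM srcM mul1r mulr1.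
by [].
Qed.

(** After summation over Δ h an element [a] of [B] contributes [α a] between
    [γ g] and [δ g'], whether it comes from [Y1] or from [Y2]. *)
Lemma balanced_sum_form γ δ b d h :
  balanced (fun a X => t a ∙ X) (fun a X => s a ∙ X) (fun Y1 Y2 =>
    \ten_(h1, h2 <- Δ h) bgd_form γ (st b 1 h1) Y1 * bgd_form δ (st 1 d h2) Y2).
Proof.
split=> [Y|Y|a Y1 Y2]; try by linearity.
move: Y1 Y2; apply: stH_ext2 => [||||c e g c' e' g']; try by linearity.
have E (x y : R1) : \ten_(h1, h2 <- Δ h) (b * x h1 * 1) * (1 * y h2 * d)
    = b * (x * y) h * d.
  rewrite convME tsum_mull tsum_mulr.
  by apply: eq_tsum => *; rewrite mulr1 mul1r !mulrA.
rewrite tgtM srcM.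
under eq_tsum do rewrite !formE; under [RHS]eq_tsum do rewrite !formE.
rewrite !E; congr (b * conv_fun _ h * d).
by rewrite !rmorphM /= !mulrA.
Qed.

Lemma balanced_form γ δ Y :
  balanced (fun a X => t a ∙ X) (fun a X => s a ∙ X) (fun X1 X2 =>
    \ten_(Y1, Y2 <- ΔL Y) bgd_form γ X1 Y1 * bgd_form δ X2 Y2).
Proof.
split=> [X|X|a X1 X2]; try by linearity.
by apply: eq_tsum => Y1 Y2; rewrite form_src form_tgt mulrA.
Qed.

(** Evaluation on elements [stH] in [X] first, then exchange of the sums, then
    evaluation in [Y]: in this order each summand is balanced. *)
Lemma form_conv γ δ X Y :
  \ten_(X1, X2 <- ΔL X) \ten_(Y1, Y2 <- ΔL Y)
    bgd_form γ X1 Y1 * bgd_form δ X2 Y2 = bgd_form (γ * δ) X Y.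
Proof.
move: X; apply: stH_ext => [||b d h].
- exact/linear_sum_comul/balanced_form.
- by linearity.
rewrite balanced_comul; last exact: balanced_form.
rewrite tsum_exchange; move: Y; apply: stH_ext => [||c e g].
- exact/linear_sum_comul/balanced_sum_form.
- by linearity.
rewrite balanced_comul; last exact: balanced_sum_form.
rewrite formE (convME γ δ) (tsum_mull (α c)) (tsum_mulr (α e)).
rewrite (linear_of_tsum (f := fun f : R1 => f h)) // tsum_mull tsum_mulr.
apply: eq_tsum => g1 g2.
rewrite mulrA -[X in conv_fun X h]mulrA convME tsum_mull tsum_mulr.
by apply: eq_tsum => h1 h2; rewrite !formE !rmorph1 !mulr1 !mul1r !mulrA.
Qed.

Lemma form_mul u X Y : bgd_cochain1 u (X ∙ Y) = bgd_form (M u) X Y.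
Proof.
move: X Y; apply: stH_ext2 => [||||b d h c e g]; try by linearity.
by rewrite cochain1M formE.
Qed.

(** The value is [v * α c * α (v g) * α e] at [h]; centrality of [v] moves [α c]
    to the front, where [bgd_form] expects it. *)
Lemma form_tgt_cochain1 v X Y : conv_C1 v ->
  bgd_cochain1 v (X ∙ t (bgd_cochain1 v Y)) = bgd_form (ι v * conv_map α v) X Y.
Proof.
move=> [_ _ vc]; move: X Y; apply: stH_ext2 => [||||b d h c e g]; try by linearity.
rewrite cochain1E tgtE cochain1M formE conv_pullmul1 conv_cst_mull rmorph1 mul1r.
congr (b * conv_fun _ h * d).
by rewrite !rmorphM /= !mulrA vc.
Qed.

(** The counit is the one-cochain of 1 and [M] is unital. *)
Lemma counit_mul X Y : bgd_counit L (X ∙ Y) = bgd_form (1 : R2) X Y.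
Proof. by have [_ _ _ ->] := bgd_represents1 B; rewrite form_mul rmorph1. Qed.

Lemma bgd_represents2 :
  represents bgd_cochain2 (@bgd_hom2 k B L) (@bgd_conv2 k B L) (@bgd_unit2 k B L).
Proof.
split=> [γ δ E||γ δ|].
- by apply: form_inj => X Y; rewrite -!cochain2E E.
- apply/seteqP; split=> [f fh|_ [γ _ <-]].
    by have [γ <-] := cochain2_surj fh; exists γ.
  split; first exact: linear_cochain2.
  by move=> b c X Y; rewrite !cochain2E form_src form_tgt mulrA.
- apply/funext => w; apply: eq_tsum => X Y; rewrite -form_conv.
  by do 2 apply: eq_tsum => ? ?; rewrite !cochain2E.
- by apply/funext => w; apply: eq_tsum => X Y; rewrite counit_mul.
Qed.

End TwoCochains.

(** * Cocycles of the Hopf algebroid *)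

Section BialgebroidCocycles.
Variables (k : fieldType) (H : hopfAlgType k) (B : modAlgType H).
Local Notation Δ := (@comul k H).
Local Notation ε := (@counit k H).
Local Notation R1 := (conv H B).
Local Notation R2 := (conv H R1).
Local Notation α := (@conv_act k H B).
Local Notation ι := (@conv_cst k H _).
Local Notation M := (@conv_pullmul k H _).
Local Notation L := (@BeH_bialgebroid k H B).
Local Notation "X ∙ Y" := (@bgd_mul k B L X Y) (at level 40, left associativity).
Local Notation s := (@bgd_src k B L).
Local Notation t := (@bgd_tgt k B L).
Local Notation ΔL := (@bgd_comul k B L).
Local Notation "X ⊠ Y" := (@bepure k B L X Y) (at level 45).
Local Notation st := (@stH k H B).

Implicit Types (γ δ : R2) (u v : R1) (X Y Z : L).

Lemma bgd_inv1E u v : u * v = 1 -> v * u = 1 ->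
  bgd_inv1 (bgd_cochain1 u : L -> B) = bgd_cochain1 v.
Proof. exact: (represents_inv (bgd_represents1 B)). Qed.

(** The left-hand side of the cocycle condition is a convolution product of two
    forms, so the condition reads [ι v * conv_map α v * M u = 1]. *)
Lemma bgd_Z1E : bgd_Z1 L = @bgd_cochain1 k H B @` @conv_Z1 k H B.
Proof.
have cocycleE u v : conv_C1 u -> u * v = 1 -> v * u = 1 ->
    (forall X Y, \ten_(X1, X2 <- ΔL X) \ten_(Y1, Y2 <- ΔL Y)
      bgd_inv1 (bgd_cochain1 u) (X1 ∙ t (bgd_inv1 (bgd_cochain1 u) Y1))
        * bgd_cochain1 u (X2 ∙ Y2) = bgd_counit L (X ∙ Y)) <->
    M u = conv_map α u * ι u.
  move=> uC uv vu; have vC := conv_C1V uC uv vu.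
  rewrite (conv_Z1P uC uv vu) (bgd_inv1E uv vu).
  have lhsE X Y : \ten_(X1, X2 <- ΔL X) \ten_(Y1, Y2 <- ΔL Y)
      bgd_cochain1 v (X1 ∙ t (bgd_cochain1 v Y1)) * bgd_cochain1 u (X2 ∙ Y2)
      = bgd_form (ι v * conv_map α v * M u) X Y.
    rewrite -form_conv; do 2 apply: eq_tsum => ? ?.
    by rewrite form_tgt_cochain1 // form_mul.
  split=> [E|E X Y]; last by rewrite lhsE E counit_mul.
  by apply: form_inj => X Y; rewrite -lhsE E counit_mul.
apply/seteqP; split=> [f [fC fZ]|_ [u [uC Mu] <-]].
  move: fC; rewrite bgd_C1E => -[u uC fE]; exists u => //.
  have [_ [v [uv vu]] _] := uC; split=> //.
  by apply/(cocycleE u v) => //; rewrite fE.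
split; first by rewrite bgd_C1E; exists u.
have [_ [v [uv vu]] _] := uC.
exact/(cocycleE u v).
Qed.

(** Multiplying [s(b x(h1)) t(d) h2] on the right by [s(c)] turns the function
    [x] into [x * α c]. *)
Lemma stHM_l (b : B) (x : R1) d h c e g :
  \ten_(h1, h2 <- Δ h) st (b * x h1) d h2 ∙ st c e g =
  \ten_(h1, r <- Δ h) \ten_(h2, h3 <- Δ r)
    st (b * (x * α c) h1) ((h3 ▷ e) * d) (h2 * g).
Proof.
under eq_tsum do rewrite stHM.
rewrite -(sweedlerA (T := fun h1 h2 q => \ten_(h3, h4 <- Δ q)
  st (b * x h1 * (h2 ▷ c)) ((h4 ▷ e) * d) (h3 * g))); try by linearity.
apply: eq_tsum => p r; rewrite tsum_exchange; apply: eq_tsum => h2 h3.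
rewrite convME tsum_mull.
rewrite (linear_of_tsum (f := fun y => st y _ _)); last by linearity.
by apply: eq_tsum => h1 h4; rewrite mulrA.
Qed.

(** The product of [Y] and [Z] twisted by the two-cochain of [γ], as it enters the
    two-cocycle condition. *)
Definition twisted_mul γ Y Z : L :=
  \ten_(Y1, Y2 <- ΔL Y) \ten_(Z1, Z2 <- ΔL Z) (s (bgd_form γ Y1 Z1) ∙ Y2) ∙ Z2.

Lemma balanced_twist1 γ Z :
  balanced (fun a X => t a ∙ X) (fun a X => s a ∙ X) (fun Y1 Y2 =>
    \ten_(Z1, Z2 <- ΔL Z) (s (bgd_form γ Y1 Z1) ∙ Y2) ∙ Z2).
Proof.
split=> [Y|Y|a Y1 Y2]; try by linearity.
by apply: eq_tsum => Z1 Z2; rewrite form_tgt src_srcM.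
Qed.

Lemma linear_twisted_mul1 γ Z : linear (fun Y => twisted_mul γ Y Z).
Proof. exact/linear_sum_comul/balanced_twist1. Qed.

(** Balanced only after the sum over Δ g: by [stHM_l] an element [a] contributes
    [α a] after [α c' * γ f * α e'] in either case. *)
Lemma balanced_twist2 γ c e g :
  balanced (fun a X => t a ∙ X) (fun a X => s a ∙ X) (fun Z1 Z2 =>
    \ten_(g1, g2 <- Δ g) (s (bgd_form γ (st c 1 g1) Z1) ∙ st 1 e g2) ∙ Z2).
Proof.
split=> [Y|Y|a Z1 Z2]; try by linearity.
move: Z1 Z2; apply: stH_ext2 => [||||c' e' f c2 e2 f2]; try by linearity.
rewrite tgtM srcM.
under eq_tsum do rewrite formE srcM !mulr1.
under [RHS]eq_tsum do rewrite formE srcM !mulr1.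
rewrite !stHM_l.
have -> // : α c' * γ f * α (e' * a) * α c2 = α c' * γ f * α e' * α (a * c2).
by rewrite !rmorphM /= !mulrA.
Qed.

Lemma twisted_mulE γ c e g c' e' f :
  twisted_mul γ (st c e g) (st c' e' f) =
  \ten_(f1, f2 <- Δ f) \ten_(g1, r <- Δ g) \ten_(g2, g3 <- Δ r)
    st (c * (α c' * γ f1) g1) ((g3 ▷ e') * e) (g2 * f2).
Proof.
rewrite /twisted_mul balanced_comul; last exact: balanced_twist1.
rewrite tsum_exchange balanced_comul; last exact: balanced_twist2.
apply: eq_tsum => f1 f2.
under eq_tsum do rewrite formE srcM !mulr1 rmorph1 mulr1.
by rewrite stHM_l rmorph1 mulr1.
Qed.

Lemma linear_twisted_mul2 γ c e g : linear (twisted_mul γ (st c e g)).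
Proof.
move=> a Z Z'; rewrite /twisted_mul !balanced_comul; try exact: balanced_twist1.
rewrite !(tsum_exchange (Δ g)).
by have -> := linear_sum_comul (balanced_twist2 γ c e g).
Qed.

(** The left-hand side of the two-cocycle condition is the product
    [conv_map (conv_map α) γ * M γ], surrounded by the contributions of the
    coefficients [b, c, c'] on the left and [e', e, d] on the right. *)
Lemma form_twisted_r γ b d h c e g c' e' f :
  bgd_form γ (st b d h) (twisted_mul γ (st c e g) (st c' e' f)) =
  b * (α c * (conv_map α (α c') * (conv_map (conv_map α) γ * M γ) f
               * conv_map α (α e')) g * α e) h * d.
Proof.
pose Λ (x : R1) := b * (α c * x * α e) h * d.
have Λl : linear Λ by rewrite /Λ; linearity.
(* [Λ] and [Λ2] surround a factor by the coefficients of the three entries. *)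
pose Λ2 (x : R2) := Λ ((conv_map α (α c') * x * conv_map α (α e')) g).
have Λ2l : linear Λ2 by rewrite /Λ2; linearity.
rewrite -[RHS]/(Λ2 _) convME (linear_of_tsum _ _ Λ2l).
have fl := linear_form2 γ (st b d h).
rewrite twisted_mulE (linear_of_tsum _ _ fl); apply: eq_tsum => f1 f2.
rewrite /Λ2 mulrA convM3E (linear_of_tsum _ _ Λl) (linear_of_tsum _ _ fl).
apply: eq_tsum => g1 r; rewrite (linear_of_tsum _ _ Λl) (linear_of_tsum _ _ fl).
apply: eq_tsum => g2 g3; rewrite formE /Λ; congr (b * conv_fun _ h * d).
have -> : (conv_map α (α c') * conv_map (conv_map α) γ f1) g1
    = α ((α c' * γ f1) g1).
  by rewrite -[conv_map (conv_map α) γ f1]/(conv_map α (γ f1)) -rmorphM.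
by move: ((α c' * γ f1) g1) => q; rewrite !rmorphM /= !mulrA.
Qed.

(** On the right-hand side the contributions of [c'] and [e'] appear inside [M], to
    the right of [γ]; see [form_cocycleE] for the comparison. *)
Lemma form_twisted_l γ b d h c e g c' e' f :
  bgd_form γ (twisted_mul γ (st b d h) (st c e g)) (st c' e' f) =
  b * (α c * (γ * M (α c' * γ f * α e')) g * α e) h * d.
Proof.
pose Λ (x : R1) := b * (α c * x * α e) h * d.
have Λl : linear Λ by rewrite /Λ; linearity.
rewrite -[RHS]/(Λ _) (convME γ) (linear_of_tsum _ _ Λl).
have fl := linear_form1 γ (st c' e' f).
rewrite twisted_mulE (linear_of_tsum _ _ fl); apply: eq_tsum => g1 g2.
rewrite /Λ mulrA convM3E (tsum_mull b) tsum_mulr (linear_of_tsum _ _ fl).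
apply: eq_tsum => h1 r.
rewrite [in RHS](tsum_mull b) tsum_mulr (linear_of_tsum _ _ fl).
apply: eq_tsum => h2 h3; rewrite formE conv_pullmulE !mulrA.
by [].
Qed.

(** [M] turns [α c'] into [conv_map α (α c')], which commutes with [γ] by
    centrality. The coefficients then agree on both sides, and evaluating at
    elements [1 ⊗ 1 # h] shows that what remains is necessary. *)
Lemma form_cocycleE γ :
  (forall b, γ * conv_map α (α b) = conv_map α (α b) * γ) ->
  (forall X Y Z, bgd_form γ X (twisted_mul γ Y Z) = bgd_form γ (twisted_mul γ X Y) Z)
  <-> conv_map (conv_map α) γ * M γ = ι γ * conv_map M γ.
Proof.
move=> γc.
have rhsE f c' e' : γ * M (α c' * γ f * α e') =
    conv_map α (α c') * (ι γ * conv_map M γ) f * conv_map α (α e').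
  rewrite conv_cst_mull !rmorphM /= !conv_pullmul_act !mulrA γc.
  by [].
split=> [E|E X Y Z].
  apply: convE => f; apply: convE => g; apply: convE => h.
  have := E (st 1 1 h) (st 1 1 g) (st 1 1 f).
  by rewrite form_twisted_r form_twisted_l rhsE !rmorph1 !mul1r !mulr1.
move: X; apply: stH_ext => [||b d h].
- by linearity.
- exact: (linear_comp (linear_form1 γ Z) (linear_twisted_mul1 γ Y)).
move: Y; apply: stH_ext => [||c e g].
- exact: (linear_comp (linear_form2 γ _) (linear_twisted_mul1 γ Z)).
- exact: (linear_comp (linear_form1 γ Z) (linear_twisted_mul2 γ b d h)).
move: Z; apply: stH_ext => [||c' e' f].
- exact: (linear_comp (linear_form2 γ _) (linear_twisted_mul2 γ c e g)).
- by linearity.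
by rewrite form_twisted_r form_twisted_l rhsE E.
Qed.

Lemma form_normE γ :
  (forall X, bgd_form γ (bgd_one L) X = bgd_counit L X /\
     bgd_form γ X (bgd_one L) = bgd_counit L X) <->
  γ 1 = 1 /\ forall h, γ h 1 = ε h *: 1.
Proof.
have lE c e g : bgd_form γ (bgd_one L) (st c e g) = c * γ g 1 * e.
  rewrite oneE formE mul1r mulr1 !conv_eval1 !conv_actE !hact1.
  by [].
have rE b d h : bgd_form γ (st b d h) (bgd_one L) = b * γ 1 h * d.
  by rewrite oneE formE !rmorph1 mul1r mulr1.
split=> [E|[E1 E2] X].
  split=> [|g].
    apply: convE => h; have [_] := E (st 1 1 h).
    by rewrite rE counit_stH !mul1r !mulr1.
  have [+ _] := E (st 1 1 g).
  by rewrite lE counit_stH !mul1r !mulr1.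
split; move: X; apply: stH_ext => [||b d h]; try exact: linear_counitL.
- by linearity.
- by rewrite lE counit_stH E2 -scalerAr mulr1 scalerAl.
- by linearity.
- by rewrite rE counit_stH E1 conv1E -scalerAr mulr1 scalerAl.
Qed.

Lemma form_centralE γ :
  (forall X Y b, bgd_form γ X (Y ∙ s b) = bgd_form γ X (Y ∙ t b)) <->
  forall b, γ * conv_map α (α b) = conv_map α (α b) * γ.
Proof.
have mulE b d h c e g a a' : bgd_form γ (st b d h) (st c e g ∙ st a a' 1) =
    b * (α c * (conv_map α (α a) * γ * conv_map α (α a')) g * α e) h * d.
  pose Λ (x : R1) := b * (α c * x * α e) h * d.
  have Λl : linear Λ by rewrite /Λ; linearity.
  have fl := linear_form2 γ (st b d h).
  rewrite -[RHS]/(Λ _) convM3E stHM (linear_of_tsum _ _ Λl) (linear_of_tsum _ _ fl).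
  apply: eq_tsum => g1 r; rewrite (linear_of_tsum _ _ Λl) (linear_of_tsum _ _ fl).
  apply: eq_tsum => g2 g3; rewrite formE mulr1 /Λ; congr (b * conv_fun _ h * d).
  by rewrite !rmorphM /= !mulrA.
split=> [E b|E X Y a].
  apply: convE => g; apply: convE => h.
  have := E (st 1 1 h) (st 1 1 g) b.
  by rewrite srcE tgtE !mulE !rmorph1 !mul1r !mulr1.
move: X Y; apply: stH_ext2 => [||||b d h c e g]; try by linearity.
by rewrite srcE tgtE !mulE !rmorph1 !mul1r !mulr1 E.
Qed.

Lemma bgd_Z2E : bgd_Z2 L = @bgd_cochain2 k H B @` @conv_Z2 k H B.
Proof.
have cochainE γ : [/\ forall X Y Z,
        bgd_cochain2 γ (X ⊠ \ten_(Y1, Y2 <- ΔL Y) \ten_(Z1, Z2 <- ΔL Z)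
                 (s (bgd_cochain2 γ (Y1 ⊠ Z1)) ∙ Y2) ∙ Z2) =
        bgd_cochain2 γ ((\ten_(X1, X2 <- ΔL X) \ten_(Y1, Y2 <- ΔL Y)
              (s (bgd_cochain2 γ (X1 ⊠ Y1)) ∙ X2) ∙ Y2) ⊠ Z),
      forall X, bgd_cochain2 γ (bgd_one L ⊠ X) = bgd_counit L X /\
        bgd_cochain2 γ (X ⊠ bgd_one L) = bgd_counit L X
    & forall X Y b, bgd_cochain2 γ (X ⊠ (Y ∙ s b)) = bgd_cochain2 γ (X ⊠ (Y ∙ t b))]
  <-> [/\ γ 1 = 1 /\ forall h, γ h 1 = ε h *: 1,
      conv_map (conv_map α) γ * M γ = ι γ * conv_map M γ
    & forall b, γ * conv_map α (α b) = conv_map α (α b) * γ].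
  have twE X Y : \ten_(X1, X2 <- ΔL X) \ten_(Y1, Y2 <- ΔL Y)
      (s (bgd_cochain2 γ (X1 ⊠ Y1)) ∙ X2) ∙ Y2 = twisted_mul γ X Y.
    by do 2 apply: eq_tsum => ? ?; rewrite cochain2E.
  split=> [[Ec En Eb]|[En Ec Eb]].
    have γc : forall b, γ * conv_map α (α b) = conv_map α (α b) * γ.
      by apply/form_centralE => X Y b; have := Eb X Y b; rewrite !cochain2E.
    split=> //.
      by apply/form_normE => X; have := En X; rewrite !cochain2E.
    apply/form_cocycleE => // X Y Z; have := Ec X Y Z.
    by rewrite !twE !cochain2E.
  split=> [X Y Z|X|X Y b].
  - by rewrite !twE !cochain2E; apply: (form_cocycleE Eb).2.
  - by rewrite !cochain2E; apply: (form_normE γ).2.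
  - by rewrite !cochain2E; apply: (form_centralE γ).2.
apply/seteqP; split=> [f [/cochain2_surj fE]|_ [γ [ui un uc ub] <-]].
  have [γ <-] := fE.
  move=> /(represents_invertible γ (bgd_represents2 B)) ui uc un ub.
  have [un' uc' ub'] := (cochainE γ).1 (And3 uc un ub).
  by exists γ.
have [_ homE _ _] := bgd_represents2 B.
have [uc' un' ub'] := (cochainE γ).2 (And3 un uc ub).
split=> //; first by rewrite homE; exists γ.
exact/(represents_invertible γ (bgd_represents2 B)).
Qed.

(** The action is a triple convolution product of forms, the outer two coming
    from [u] and its inverse. *)
Lemma bgd_act2E u v γ : conv_C1 u -> u * v = 1 -> v * u = 1 ->
  bgd_act2 (bgd_cochain2 γ) (bgd_cochain1 u : L -> B) = bgd_cochain2 (gauge u v γ).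
Proof.
move=> uC uv vu; have vC := conv_C1V uC uv vu.
apply/funext => w; apply: eq_tsum => X Y; rewrite (bgd_inv1E uv vu).
rewrite /gauge -(mulrA _ γ) -form_conv; apply: eq_tsum => X1 X'.
rewrite [LHS]tsum_exchange; apply: eq_tsum => Y1 Y'.
rewrite -form_conv tsum_mull; apply: eq_tsum => X2 X3.
rewrite tsum_mull; apply: eq_tsum => Y2 Y3.
by rewrite cochain2E form_tgt_cochain1 // form_mul mulrA.
Qed.

Lemma bgd_H2E : bgd_H2 L =
  (fun O => @bgd_cochain2 k H B @` O) @` (@gauge_orbit k H B @` @conv_Z2 k H B).
Proof.
rewrite /bgd_H2 bgd_Z2E bgd_C1E; apply: gauge_orbits_image => u v γ.
exact: bgd_act2E.
Qed.

End BialgebroidCocycles.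

Theorem proposition4p10 (k : fieldType) (H : hopfAlgType k) (B : modAlgType H) :
  let L := BeH_bialgebroid B in
  [/\ group_isomorphic
        (bgd_Z1 L) (bgd_conv1 L) (bgd_counit L)
        (hopf_Z1 H B) (hopf_conv1 H B) (hopf_unit1 H B),
      group_isomorphic
        (bgd_C1 L) (bgd_conv1 L) (bgd_counit L)
        (hopf_C1 H B) (hopf_conv1 H B) (hopf_unit1 H B),
      bijective_sets (bgd_Z2 L) (hopf_Z2 H B)
    & bijective_sets (bgd_H2 L) (hopf_H2 H B)].
Proof.
move=> L; rewrite bgd_Z1E hopf_Z1E bgd_C1E hopf_C1E.
rewrite bgd_Z2E hopf_Z2E bgd_H2E hopf_H2E.
have bgd2_inj : injective (@bgd_cochain2 k H B) by case: (bgd_represents2 B).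
have hopf2_inj : injective (@hopf_cochain2 k H B) by case: (hopf_represents2 B).
split.
- apply: group_isomorphic_image (bgd_represents1 B) (hopf_represents1 B).
  + exact: conv_Z1_1.
  + exact: conv_Z1M.
  + move=> u uZ; have [[_ [v [uv vu]] _] _] := uZ.
    by exists v; split=> //; apply: conv_Z1V uZ uv vu.
- apply: group_isomorphic_image (bgd_represents1 B) (hopf_represents1 B).
  + exact: conv_C1_1.
  + exact: conv_C1M.
  + move=> u uC; have [_ [v [uv vu]] _] := uC.
    by exists v; split=> //; apply: conv_C1V uC uv vu.
- exact: (bijective_sets_image (0 : conv H (conv H B))).
- by apply: (bijective_sets_image set0); apply: image_set_inj.
Qed.
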